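(* In the non-collaborative variant of the concurrent interpolation search tree (IST), the insertion and deletion operations are lock-free, and the lookup operation is wait-free.
   Context: MODEL. Finitely many (at most $p$) asynchronous threads take arbitrarily interleaved atomic steps on a shared memory; nodes are freshly allocated and never reused. Atomic primitives: READ, WRITE, CAS, FETCH_AND_ADD, and $\mathrm{DCSS}(x,o,w,y,o')$, which atomically writes $w$ to address $x$ and returns SUCCESS if $x$ holds $o$ and $y$ holds $o'$, and otherwise changes nothing and returns FAILED_MAIN_ADDRESS (if $x$ did not match) or FAILED_AUX_ADDRESS (if $y$ did not match). Entries of children arrays are read atomically (primitive DCSS_READ). An operation is wait-free if every invocation completes within a finite number of the invoking thread's own steps, regardless of the other threads; operations are lock-free if, whenever threads executing them keep taking steps, some operation completes after a finite number of steps. DATA. Keys come from a totally ordered set $\mathbb{K}$. A node is one of: Empty; Single(key, val); Inner(initSize, degree $d$, keys $k_0<\dots<k_{d-2}$, children[$0..d-1$], status, count), where status is a triple (integer, boolean, boolean), initially $[0,\bot,\bot]$, count is initially $0$, initSize is the number of keys in the subtree at the node's creation, and all fields other than the children entries, status and count are immutable; Rebuild(target: Inner, parent: Inner, index: int). An IST $I$ has a field root, pointing to a permanent sentinel Inner node of degree 1 (no keys) whose single child is Empty in a newly created IST. An ideal IST on $n$ keys is: Empty if $n=0$, Single if $n=1$, and otherwise an Inner node of degree $\lfloor\sqrt n\rfloor$ or $\lceil\sqrt n\rceil$ whose child subtrees are ideal ISTs each with $\lfloor\sqrt n\rfloor$ or $\lceil\sqrt n\rceil$ keys. In each Inner node,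 children[$i$] is responsible for the keys in $[k_{i-1},k_i)$ (within the parent's interval). $R>0$ is a fixed constant (the rebuild threshold). interpolationSearch($k,n$) returns the index $i$ with $k_{i-1}\le k<k_i$ in $n$'s keys (with $k_{-1}=-\infty$, $k_{d-1}=+\infty$). OPERATIONS. insert($I,k,v$): path := empty list; $n:=I.\mathrm{root}$; loop: $i:=$ interpolationSearch($k,n$); $c:=n.\mathrm{children}[i]$. If $c$ is Inner: $n:=c$ and append $(c,i)$ to path. If $c$ is Rebuild: helpRebuild($c$), then restart insert from the root. If $c$ is Empty or Single: create $r$, which is Single($k,v$) if $c$ is Empty or has key $k$, and otherwise an Inner node of degree 2, initSize 2, with the two Single children holding the key of $c$ and the key $k$ in order; execute DCSS($n$.children[$i$], $c$, $r$, $n$.status, $[0,\bot,\bot]$). On FAILED_MAIN_ADDRESS repeat the loop from the same $n$; on FAILED_AUX_ADDRESS restart from the root; on SUCCESS, FETCH_AND_ADD($m$.count, 1) for every $m$ in path, then going down the path find the first $(m,j)$ with $m.\mathrm{count}\ge R\cdot m.\mathrm{initSize}$, if any, and call rebuild($m$, parent, $j$), where parent is the predecessor of $m$ on the path ($I$.root for the first); return. delete($I,k$): the same, except that if $c$ is Empty or a Single with key $\ne k$ it returns without changing anything, and if $c$ is a Single with key $k$ then $r$ is a new Empty node. lookup($I,k$): $n:=I.\mathrm{root}$; loop: if $n$ is Inner, $n:=n.\mathrm{children}[\text{interpolationSearch}(k,n)]$; if $n$ is Single, return its value if its key is $k$ and null otherwise; if $n$ is Empty return null; if $n$ is Rebuild,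 $n:=n.\mathrm{target}$. rebuild($u,q,i$): op := new Rebuild($u,q,i$); if DCSS($q$.children[$i$], $u$, op, $q$.status, $[0,\bot,\bot]$) succeeds then helpRebuild(op). helpRebuild(op): keyCount := markAndCount(op.target); ideal := createIdeal(op.target, keyCount), a newly allocated ideal IST holding exactly the keys (with values) in the subtree of op.target; $q$ := op.parent; DCSS($q$.children[op.index], op, ideal, $q$.status, $[0,\bot,\bot]$). markAndCount($u$): if $u$ is Empty return 0; if Single return 1; if Rebuild return markAndCount($u$.target). Otherwise ($u$ Inner): CAS($u$.status, $[0,\bot,\bot]$, $[0,\bot,\top]$); keyCount := 0; for each index read the child $c$: if $c$ is Inner, read its status $[\text{count},\text{finished},\text{started}]$ and add count if finished, else add markAndCount($c$); if $c$ is Rebuild add markAndCount($c$); if $c$ is Single add 1. Then CAS($u$.status, $[0,\bot,\top]$, $[\text{keyCount},\top,\top]$) and return keyCount. *)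

(* Defs.v *)
From mathcomp Require Import all_boot all_order all_algebra.
From mathcomp Require Import reals.
From Stdlib Require PeanoNat.

Set Implicit Arguments.
Unset Strict Implicit.
Unset Printing Implicit Defensive.

Import Order.TTheory GRing.Theory Num.Theory.

Section ConcurrentIST.

Context {disp : Order.disp_t} {K : orderType disp} {V : Type}.
Context {F : realType} (R : F) (p : nat).

Definition addr := nat.

(* [count, finished, started] *)
Definition status := (nat * bool * bool)%type.
Definition clean : status := (0, false, false).
Definition started : status := (0, false, true).
Definition finished (n : nat) : status := (n, true, true).

Record inner := MkInner {
  init_size : nat;
  keys : seq K;
  children : seq addr;
  stat : status;
  cnt : nat
}.

Definition degree (u : inner) : nat := size (children u).

Inductive node :=
| Empty
| Single (k : K) (v : V)
| Inner (u : inner)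
| Rebuild (target parent : addr) (index : nat).

(* The address of a node is its position; allocation appends at the end, so
   that addresses are never reused. *)
Definition heap := seq node.

Definition node_at (h : heap) (a : addr) : option node := onth h a.

Definition child (h : heap) (n : addr) (i : nat) : option addr :=
  if node_at h n is Some (Inner u) then onth (children u) i else None.

Definition status_at (h : heap) (n : addr) : option status :=
  if node_at h n is Some (Inner u) then Some (stat u) else None.

Definition update (h : heap) (n : addr) (f : inner -> inner) : heap :=
  if node_at h n is Some (Inner u) then set_nth Empty h n (Inner (f u)) else h.

Definition set_child (i : nat) (c : addr) (u : inner) : inner :=
  MkInner (init_size u) (keys u) (set_nth c (children u) i c) (stat u) (cnt u).

Definition set_status (st : status) (u : inner) : inner :=
  MkInner (init_size u) (keys u) (children u) st (cnt u).

Definition incr_count (u : inner) : inner :=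
  MkInner (init_size u) (keys u) (children u) (stat u) (cnt u).+1.

Definition fetch_and_add_count (h : heap) (n : addr) : heap :=
  update h n incr_count.

Definition cas_status (h : heap) (n : addr) (old new : status) : heap :=
  update h n (fun u => if stat u == old then set_status new u else u).

Inductive dcss_result := Success | FailedMainAddress | FailedAuxAddress.

(* DCSS(n.children[i], o, w, y.status, o').  When neither address matches,
   either failure may be reported. *)
Inductive dcss (h : heap) (n : addr) (i : nat) (o w : addr)
    (y : addr) (o' : status) : dcss_result -> heap -> Prop :=
| DcssSuccess of child h n i = Some o & status_at h y = Some o' :
    dcss h n i o w y o' Success (update h n (set_child i w))
| DcssFailedMain of child h n i <> Some o :
    dcss h n i o w y o' FailedMainAddress h
| DcssFailedAux of status_at h y <> Some o' :
    dcss h n i o w y o' FailedAuxAddress h.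

(* The first i with k < k_i, or the number of keys if there is none. *)
Definition interpolation_search (k : K) (ks : seq K) : nat :=
  find (fun x => (k < x)%O) ks.

Definition near_sqrt (n m : nat) : bool :=
  (m == PeanoNat.Nat.sqrt n) || (m == PeanoNat.Nat.sqrt_up n).

(* [separated ks parts]: child i is responsible for all the keys of part i. *)
Definition separated (ks : seq K) (parts : seq (seq (K * V))) : Prop :=
  [/\ size parts = (size ks).+1,
      sorted (fun x y : K => (x < y)%O) ks
    & forall (i : nat) (part : seq (K * V)), onth parts i = Some part ->
      all (fun kv => interpolation_search kv.1 ks == i) part].

(* [new_ideal h kvs h' a]: allocating, in h, an ideal IST holding exactly the
   key-value pairs kvs can result in the heap h' and the address a. *)
Inductive new_ideal : heap -> seq (K * V) -> heap -> addr -> Prop :=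
| NewIdealEmpty (h : heap) :
    new_ideal h [::] (rcons h Empty) (size h)
| NewIdealSingle (h : heap) (k : K) (v : V) :
    new_ideal h [:: (k, v)] (rcons h (Single k v)) (size h)
| NewIdealInner (h h' : heap) (kvs : seq (K * V)) (parts : seq (seq (K * V)))
    (ks : seq K) (cs : seq addr) of
    2 <= size kvs & kvs = flatten parts & near_sqrt (size kvs) (size parts)
    & all (near_sqrt (size kvs)) (map size parts) & separated ks parts
    & new_ideals h parts h' cs :
    new_ideal h kvs
      (rcons h' (Inner (MkInner (size kvs) ks cs clean 0))) (size h')
with new_ideals :
    heap -> seq (seq (K * V)) -> heap -> seq addr -> Prop :=
| NewIdealsNil (h : heap) : new_ideals h [::] h [::]
| NewIdealsCons (h h1 h2 : heap) (part : seq (K * V))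
    (parts : seq (seq (K * V))) (c : addr) (cs : seq addr) of
    new_ideal h part h1 c & new_ideals h1 parts h2 cs :
    new_ideals h (part :: parts) h2 (c :: cs).

(* Every transition below performs at most one primitive on the mutable
   fields of shared nodes.  Reading immutable fields, creating nodes that are
   not yet shared and moving the control do not count as primitives. *)

Definition ist_root : addr := 0.
Definition init_heap : heap :=
  [:: Inner (MkInner 0 [::] [:: 1] clean 0); Empty].

Inductive operation := Insert (k : K) (v : V) | Delete (k : K) | Lookup (k : K).

Definition op_key (o : operation) : K :=
  match o with Insert k _ => k | Delete k => k | Lookup k => k end.

Definition is_update (o : operation) : bool :=
  match o with Lookup _ => false | _ => true end.
Definition is_lookup (o : operation) : bool :=
  match o with Lookup _ => true | _ => false end.

(* A frame (u, i, n) is an activation of markAndCount on the Inner node u whose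
   loop is about to treat, or is waiting for the result of, the i-th child,
   and whose keyCount is n. *)
Definition frame := (addr * nat * nat)%type.

Inductive mark_pc :=
| MarkCall (u : addr) (stack : seq frame)
| MarkLoop (u : addr) (i n : nat) (stack : seq frame)
| MarkStatus (c : addr) (u : addr) (i n : nat) (stack : seq frame)
| MarkReturn (n : nat) (stack : seq frame).

Inductive mark_step (h : heap) : mark_pc -> heap -> mark_pc -> Prop :=
| MarkCallEmpty u stk of node_at h u = Some Empty :
    mark_step h (MarkCall u stk) h (MarkReturn 0 stk)
| MarkCallSingle u stk k v of node_at h u = Some (Single k v) :
    mark_step h (MarkCall u stk) h (MarkReturn 1 stk)
| MarkCallRebuild u stk target q i of
    node_at h u = Some (Rebuild target q i) :
    mark_step h (MarkCall u stk) h (MarkCall target stk)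
| MarkCallInner u stk w of node_at h u = Some (Inner w) :
    mark_step h (MarkCall u stk)
      (cas_status h u clean started) (MarkLoop u 0 0 stk)
| MarkLoopEmpty u i n stk c of
    child h u i = Some c & node_at h c = Some Empty :
    mark_step h (MarkLoop u i n stk) h (MarkLoop u i.+1 n stk)
| MarkLoopSingle u i n stk c k v of
    child h u i = Some c & node_at h c = Some (Single k v) :
    mark_step h (MarkLoop u i n stk) h (MarkLoop u i.+1 n.+1 stk)
| MarkLoopRebuild u i n stk c target q j of
    child h u i = Some c & node_at h c = Some (Rebuild target q j) :
    mark_step h (MarkLoop u i n stk) h (MarkCall c ((u, i, n) :: stk))
| MarkLoopInner u i n stk c w of
    child h u i = Some c & node_at h c = Some (Inner w) :
    mark_step h (MarkLoop u i n stk) h (MarkStatus c u i n stk)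
| MarkStatusFinished c u i n stk m b of
    status_at h c = Some (m, true, b) :
    mark_step h (MarkStatus c u i n stk) h (MarkLoop u i.+1 (n + m) stk)
| MarkStatusUnfinished c u i n stk m b of
    status_at h c = Some (m, false, b) :
    mark_step h (MarkStatus c u i n stk) h (MarkCall c ((u, i, n) :: stk))
| MarkLoopExit u n stk w of node_at h u = Some (Inner w) :
    mark_step h (MarkLoop u (degree w) n stk)
      (cas_status h u started (finished n)) (MarkReturn n stk)
| MarkReturnFrame m u i n stk :
    mark_step h (MarkReturn m ((u, i, n) :: stk)) h
      (MarkLoop u i.+1 (n + m) stk).

(* createIdeal: the pairs in the subtree of the target are collected in key
   order, with one READ for each entry of a children array; then an ideal IST on
   these pairs is allocated. *)
Inductive collect_pc :=
| Visit (u : addr) (stack : seq (addr * nat)) (kvs : seq (K * V))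
| Collect (stack : seq (addr * nat)) (kvs : seq (K * V)).

Inductive collect_step (h : heap) : collect_pc -> collect_pc -> Prop :=
| VisitEmpty u stk kvs of node_at h u = Some Empty :
    collect_step h (Visit u stk kvs) (Collect stk kvs)
| VisitSingle u stk kvs k v of node_at h u = Some (Single k v) :
    collect_step h (Visit u stk kvs) (Collect stk (rcons kvs (k, v)))
| VisitRebuild u stk kvs target q i of
    node_at h u = Some (Rebuild target q i) :
    collect_step h (Visit u stk kvs) (Visit target stk kvs)
| VisitInner u stk kvs w of node_at h u = Some (Inner w) :
    collect_step h (Visit u stk kvs) (Collect ((u, 0) :: stk) kvs)
| CollectChild u i stk kvs c of child h u i = Some c :
    collect_step h (Collect ((u, i) :: stk) kvs)
      (Visit c ((u, i.+1) :: stk) kvs)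
| CollectExit u stk kvs w of node_at h u = Some (Inner w) :
    collect_step h (Collect ((u, degree w) :: stk) kvs) (Collect stk kvs).

Inductive help_pc :=
| HelpStart
| HelpMark (m : mark_pc)
| HelpCreate (key_count : nat) (c : collect_pc)
| Install (ideal : addr)
| HelpDone.

Inductive help_step (op : addr) (h : heap) : help_pc -> heap -> help_pc -> Prop :=
| HelpStartStep target q i of node_at h op = Some (Rebuild target q i) :
    help_step op h HelpStart h (HelpMark (MarkCall target [::]))
| HelpMarkStep m h' m' of mark_step h m h' m' :
    help_step op h (HelpMark m) h' (HelpMark m')
| HelpMarkExit n target q i of node_at h op = Some (Rebuild target q i) :
    help_step op h (HelpMark (MarkReturn n [::])) h
      (HelpCreate n (Visit target [::] [::]))
| HelpCreateStep n c c' of collect_step h c c' :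
    help_step op h (HelpCreate n c) h (HelpCreate n c')
| HelpCreateExit n kvs h' ideal of new_ideal h kvs h' ideal :
    help_step op h (HelpCreate n (Collect [::] kvs)) h' (Install ideal)
| InstallStep ideal target q i r h' of
    node_at h op = Some (Rebuild target q i)
    & dcss h q i op ideal q clean r h' :
    help_step op h (Install ideal) h' HelpDone.

Definition new_pair (h : heap) (k1 : K) (v1 : V) (k2 : K) (v2 : V) :
    heap * addr :=
  (h ++ [:: Single k1 v1; Single k2 v2;
            Inner (MkInner 2 [:: k2] [:: size h; (size h).+1] clean 0)],
   (size h).+2).

(* Creation of the node r that replaces the leaf c; None if the operation
   returns without changing anything. *)
Definition new_replacement (h : heap) (o : operation) (c : node) :
    option (heap * addr) :=
  match o, c with
  | Insert k v, Empty => Some (rcons h (Single k v), size h)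
  | Insert k v, Single k' v' =>
      if k' == k then Some (rcons h (Single k v), size h)
      else if (k' < k)%O then Some (new_pair h k' v' k v)
      else Some (new_pair h k v k' v')
  | Delete k, Single k' _ =>
      if k' == k then Some (rcons h Empty, size h) else None
  | _, _ => None
  end.

Definition is_leaf (c : node) : bool :=
  match c with Empty | Single _ _ => true | _ => false end.

Inductive continuation := Restart | Finish.

(* Pairs (node, index in the children of its parent), from the top of the tree
   to the bottom. *)
Definition tree_path := seq (addr * nat).

Inductive pc :=
| Descend (ns : tree_path) (n : addr)
| Update (ns : tree_path) (n : addr) (i : nat) (c : addr)
| IncrCounts (todo : tree_path) (ns : tree_path)
| CheckCounts (parent : addr) (todo : tree_path)
| StartRebuild (u q : addr) (i : nat)
| Help (op : addr) (k : continuation) (s : help_pc)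
| Search (n : addr)
| Return (r : option V).

Definition start (o : operation) : pc :=
  if o is Lookup _ then Search ist_root else Descend [::] ist_root.

Inductive op_step (o : operation) (h : heap) : pc -> heap -> pc -> Prop :=
| DescendInner ns n u i c w of
    node_at h n = Some (Inner u)
    & i = interpolation_search (op_key o) (keys u)
    & child h n i = Some c & node_at h c = Some (Inner w) :
    op_step o h (Descend ns n) h (Descend (rcons ns (c, i)) c)
| DescendRebuild ns n u i c target q j of
    node_at h n = Some (Inner u)
    & i = interpolation_search (op_key o) (keys u)
    & child h n i = Some c & node_at h c = Some (Rebuild target q j) :
    op_step o h (Descend ns n) h (Help c Restart HelpStart)
| DescendLeaf ns n u i c x of
    node_at h n = Some (Inner u)
    & i = interpolation_search (op_key o) (keys u)
    & child h n i = Some c & node_at h c = Some x & is_leaf x :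
    op_step o h (Descend ns n) h (Update ns n i c)
| UpdateNothing ns n i c x of
    node_at h c = Some x & new_replacement h o x = None :
    op_step o h (Update ns n i c) h (Return None)
| UpdateSuccess ns n i c x h1 r h2 of
    node_at h c = Some x & new_replacement h o x = Some (h1, r)
    & dcss h1 n i c r n clean Success h2 :
    op_step o h (Update ns n i c) h2 (IncrCounts ns ns)
| UpdateFailedMain ns n i c x h1 r h2 of
    node_at h c = Some x & new_replacement h o x = Some (h1, r)
    & dcss h1 n i c r n clean FailedMainAddress h2 :
    op_step o h (Update ns n i c) h2 (Descend ns n)
| UpdateFailedAux ns n i c x h1 r h2 of
    node_at h c = Some x & new_replacement h o x = Some (h1, r)
    & dcss h1 n i c r n clean FailedAuxAddress h2 :
    op_step o h (Update ns n i c) h2 (Descend [::] ist_root)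
| IncrCountsStep m j todo ns :
    op_step o h (IncrCounts ((m, j) :: todo) ns)
      (fetch_and_add_count h m) (IncrCounts todo ns)
| IncrCountsExit ns :
    op_step o h (IncrCounts [::] ns) h (CheckCounts ist_root ns)
| CheckCountsAbove parent m j todo u of
    node_at h m = Some (Inner u)
    & (R * (init_size u)%:R <= (cnt u)%:R)%R :
    op_step o h (CheckCounts parent ((m, j) :: todo)) h
      (StartRebuild m parent j)
| CheckCountsBelow parent m j todo u of
    node_at h m = Some (Inner u)
    & ((cnt u)%:R < R * (init_size u)%:R)%R :
    op_step o h (CheckCounts parent ((m, j) :: todo)) h (CheckCounts m todo)
| CheckCountsExit parent :
    op_step o h (CheckCounts parent [::]) h (Return None)
| StartRebuildSuccess u q i h' of
    dcss (rcons h (Rebuild u q i)) q i u (size h) q clean Success h' :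
    op_step o h (StartRebuild u q i) h' (Help (size h) Finish HelpStart)
| StartRebuildFailed u q i r h' of
    dcss (rcons h (Rebuild u q i)) q i u (size h) q clean r h'
    & r <> Success :
    op_step o h (StartRebuild u q i) h' (Return None)
| HelpStep op k s h' s' of help_step op h s h' s' :
    op_step o h (Help op k s) h' (Help op k s')
| HelpRestart op :
    op_step o h (Help op Restart HelpDone) h (Descend [::] ist_root)
| HelpFinish op :
    op_step o h (Help op Finish HelpDone) h (Return None)
| SearchInner n u c of
    node_at h n = Some (Inner u)
    & child h n (interpolation_search (op_key o) (keys u)) = Some c :
    op_step o h (Search n) h (Search c)
| SearchSingle n k v of node_at h n = Some (Single k v) :
    op_step o h (Search n) h
      (Return (if k == op_key o then Some v else None))
| SearchEmpty n of node_at h n = Some Empty :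
    op_step o h (Search n) h (Return None)
| SearchRebuild n target q i of node_at h n = Some (Rebuild target q i) :
    op_step o h (Search n) h (Search target).

(* [Idle r]: no pending operation; r is the last value returned. *)
Inductive thread := Idle (r : option V) | Running (o : operation) (s : pc).

Record config := Config { mem : heap; threads : 'I_p -> thread }.

Definition set_thread (c : config) (h : heap) (t : 'I_p) (x : thread) : config :=
  Config h (fun t' => if t' == t then x else threads c t').

Definition init_config : config := Config init_heap (fun _ => Idle None).

Inductive step (c : config) (t : 'I_p) : config -> Prop :=
| StepInvoke r o of threads c t = Idle r :
    step c t (set_thread c (mem c) t (Running o (start o)))
| StepRun o s h' s' of threads c t = Running o s & op_step o (mem c) s h' s' :
    step c t (set_thread c h' t (Running o s'))
| StepReturn o r of threads c t = Running o (Return r) :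
    step c t (set_thread c (mem c) t (Idle r)).

(* [sched m] is the thread that takes the step number m.  It is None when no
   thread takes a step, so that finite executions are covered as well. *)
Definition execution (c : nat -> config) (sched : nat -> option 'I_p) : Prop :=
  c 0 = init_config /\
  forall m, if sched m is Some t then step (c m) t (c m.+1)
            else c m.+1 = c m.

Definition executing (P : pred operation) (c : config) (t : 'I_p) : Prop :=
  exists o s, threads c t = Running o s /\ P o.

Definition completes (P : pred operation) (c : nat -> config)
    (sched : nat -> option 'I_p) (t : 'I_p) (m : nat) : Prop :=
  [/\ sched m = Some t, executing P (c m) t
    & exists r, threads (c m.+1) t = Idle r].

(* A pending operation never gets stuck for want of a transition; without this
   an operation could satisfy the progress conditions by blocking. *)
Definition never_stuck (P : pred operation) : Prop :=
  forall c sched, execution c sched ->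
  forall (t : 'I_p) (n : nat), executing P (c n) t ->
  exists c', step (c n) t c'.

(* If steps of operations of the class P are taken forever, then at any time
   some operation of the class completes later. *)
Definition lock_free (P : pred operation) : Prop :=
  never_stuck P /\
  forall c sched, execution c sched ->
  (forall n, exists m t, [/\ n <= m, sched m = Some t & executing P (c m) t]) ->
  forall n, exists m t, n <= m /\ completes P c sched t m.

(* A pending operation of the class P whose thread takes infinitely many steps
   completes, whatever the other threads do. *)
Definition wait_free (P : pred operation) : Prop :=
  never_stuck P /\
  forall c sched, execution c sched ->
  forall (t : 'I_p) (n : nat), executing P (c n) t ->
  (forall n', exists m, n' <= m /\ sched m = Some t) ->
  exists m, n <= m /\ completes P c sched t m.

End ConcurrentIST.

(* Main.v *)
(** Slots of children arrays only ever receive freshly allocated nodes, so the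
    address stored in a slot never decreases, and every node has a single
    slot, its home, in which it can ever be stored.  A node whose home holds a
    larger address is detached, for good; a node is dead if it or one of its
    ancestors along the homes is detached.  Only dead nodes are ever marked, so
    that a thread that descends through nodes that are not dead finds clean
    statuses.

    Lookups.  If infinitely many updates of one thread took place below a node
    [u], the count of [u] would exceed the threshold; the next update below [u]
    would then try to rebuild [u] or an ancestor, after which [u] is dead
    whether or not the DCSS succeeds, and operations started later no longer
    descend into a detached node.  So finitely many updates take place below
    [u], hence finitely many rebuildings, and each of them is installed at most
    once: the slots below [u] are eventually constant, and a lookup that runs
    through them reaches a leaf.

    Updates.  If no update completes any more, the same argument applies to the
    whole tree.  In a tree with constant slots each of the loops is finite, and
    after one restart an update only meets nodes that are not dead, where its
    DCSS cannot fail. *)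
Require Import Defs.
From mathcomp Require Import all_boot all_order all_algebra.
From mathcomp Require Import reals boolp zify.

Set Implicit Arguments.
Unset Strict Implicit.
Unset Printing Implicit Defensive.

Import Order.TTheory GRing.Theory Num.Theory.

(* Progress also requires that no operation block. The delicate case is [createIdeal]: it reads a
   tree that other threads keep changing, so the pairs it collects need not have been present at any
   single moment, yet an ideal tree on them requires strictly increasing keys. Hence a home also
   fixes a set of keys. This set never changes, the sets of the children of a node are disjoint and
   ordered, and a traversal in the order of the children yields increasing keys whatever the
   interleaving.

   Homes and key sets are chosen at allocation; since addresses are never reused, the choices made
   along an execution fit together into one function.

   For lookups the argument has to be local to a subtree, as updates elsewhere may never stop. The
   count of the root is never incremented and the root is never rebuilt, so nothing bounds the
   changes of its slot; but a lookup reads this slot only once. *)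
Scheme new_ideal_mut := Minimality for new_ideal Sort Prop
with new_ideals_mut := Minimality for new_ideals Sort Prop.

(** * Eventual properties of sequences *)

(** Applied to the threads, this is where their finite number enters. *)
Lemma eventually_fin (T : finType) (P : T -> nat -> Prop) (n : nat) :
  (forall x, exists2 N, n <= N & forall m, N <= m -> P x m) ->
  exists2 N, n <= N & forall x m, N <= m -> P x m.
Proof.
move=> ev; pose f x := s2val (cid2 (ev x)).
exists (maxn n (\max_x f x)); first exact: leq_maxl.
move=> x m; rewrite geq_max => /andP[_ le]; apply: (s2valP' (cid2 (ev x))).
by apply: leq_trans le; apply: (leq_bigmax x).
Qed.

Lemma eventually_ltn (P : nat -> nat -> Prop) (k n : nat) :
  (forall x, x < k -> exists2 N, n <= N & forall m, N <= m -> P x m) ->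
  exists2 N, n <= N & forall x m, x < k -> N <= m -> P x m.
Proof.
move=> ev; have [|N le PN] := @eventually_fin 'I_k (fun x m => P x m) n.
  by move=> x; apply: ev.
by exists N => // x m lt_x; apply: (PN (Ordinal lt_x)).
Qed.

(* A set of states that is never left and is entered whenever [E] occurs, but in
   which [E] does not occur, shows that [E] occurs at most once. *)
Lemma eventually_not (E Z : nat -> Prop) (n : nat) :
  (forall m, n <= m -> E m -> Z m.+1) ->
  (forall m, n <= m -> Z m -> Z m.+1) ->
  (forall m, n <= m -> Z m -> ~ E m) ->
  exists2 N, n <= N & forall m, N <= m -> ~ E m.
Proof.
move=> EZ ZZ ZE; case: (pselect (exists2 m, n <= m & E m)) => [[m le Em]|no].
  exists m.+1; first exact: leqW.
  have Z_ m' : m < m' -> Z m'.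
    elim: m' => // m' IH; rewrite ltnS leq_eqVlt => /orP[/eqP<-|lt].
      exact: EZ.
    by apply: ZZ (IH lt); lia.
  by move=> m' lt; apply: ZE (Z_ _ lt); lia.
by exists n => // m le Em; apply: no; exists m.
Qed.

Lemma bounded_stable (f : nat -> nat) (B : nat) :
  (forall m, f m <= f m.+1) -> (forall m, f m < B) ->
  exists N, forall m, N <= m -> f m = f N.
Proof.
move=> mono bd.
have le_f m n : m <= n -> f m <= f n.
  move/subnK<-; elim: (n - m) => //= d IH; exact: leq_trans (mono _).
have : B - f 0 <= B by apply: leq_subr.
(* [k] bounds the room left below [B]; each increase of [f] uses up at least one unit of it. *)
move: {2}B 0 => k; elim: k => [|k IH] N le_k; first by have := bd N; lia.
case: (pselect (exists2 m, N <= m & f N < f m)) => [[m le lt]|no].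
  by apply: (IH m); have := bd m; lia.
exists N => m le; apply/eqP; rewrite eqn_leq (le_f _ _ le) andbT leqNgt.
by apply/negP => lt; apply: no; exists m.
Qed.

Section ConcurrentIST.

Context {disp : Order.disp_t} {K : orderType disp} {V : Type}.

Local Notation node := (@node disp K V).
Local Notation heap := (@heap disp K V).
Local Notation inner := (@inner disp K).
Local Notation operation := (@operation disp K V).
Local Notation collect_pc := (@collect_pc disp K V).
Local Notation help_pc := (@help_pc disp K V).
Local Notation pc := (@pc disp K V).
Local Notation thread := (@thread disp K V).

(** * Ghost state and heap invariants *)

Section Invariants.

(* [up] and [idx] are the parent and the index of the home of a node, [rng] is
   the set of the keys whose search can lead to the node.  They are chosen when
   the node is allocated and are not part of the memory. *)
Record ghost := Ghost {
  up : addr;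
  idx : nat;
  dep : nat;
  rng : K -> Prop
}.

Implicit Types (G : addr -> ghost) (h : heap) (u : inner).

Definition is_inner h a := exists u, node_at h a = Some (Inner u).

Definition is_rebuild h a :=
  exists t q i, node_at h a = Some (Rebuild t q i).

(** It speaks of a ghost and not of an address, so that a new node can take over the ghost of the
    node it is meant to replace. *)
Definition belongs_ghost G h (q : addr) (i : nat) (g : ghost) :=
  [/\ up g = q, idx g = i, dep g = (dep (G q)).+1
    & exists2 u, node_at h q = Some (Inner u)
        & forall x, rng g x <->
            rng (G q) x /\ interpolation_search x (keys u) = i].

Definition belongs G h q i c :=
  [/\ c < size h, c <> 0 & belongs_ghost G h q i (G c)].

(** Holds from the moment the node is first stored in its home; a new node whose DCSS failed need
    not satisfy it. *)
Definition placed G h m :=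
  exists2 c, child h (up (G m)) (idx (G m)) = Some c & m <= c.

(** The root is its own ghost parent; without its exclusion, its own child would make it look
    replaced. *)
Definition detached G h m :=
  m <> 0 /\ exists2 c, child h (up (G m)) (idx (G m)) = Some c & m < c.

Definition ancestor G j (a : addr) := iter j (fun b => up (G b)) a.

Definition dead G h a := exists j, detached G h (ancestor G j a).

(** A [Rebuild] node shares the home of its target and is younger, so that storing it detaches the
    target. Conversely, a [Rebuild] found in a slot names exactly this slot, so that any helper
    tries to install the ideal tree where the node was found. *)
Definition node_ok G h a (x : node) : Prop :=
  match x with
  | Empty => True
  | Single k _ => rng (G a) k
  | Inner u =>
      [/\ size (children u) = (size (keys u)).+1,
          forall i c, onth (children u) i = Some c ->
            belongs G h a i c /\
            forall t q j, node_at h c = Some (Rebuild t q j) -> q = a /\ j = i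
        & stat u <> clean -> dead G h a]
  | Rebuild t q i =>
      [/\ t < a, is_inner h t, belongs G h q i t, placed G h t
        & belongs G h q i a]
  end.

Definition heap_ok G h :=
  [/\ is_inner h 0, up (G 0) = 0, forall x, rng (G 0) x,
      forall a, a < size h -> up (G a) < size h
    & forall a x, node_at h a = Some x -> node_ok G h a x].

(** The order along which nodes evolve. The status is left free here: what is known about it is its
    link with deadness in [node_ok]. *)
Definition node_ext (x y : node) : Prop :=
  match x, y with
  | Inner u, Inner u' =>
      [/\ init_size u' = init_size u, keys u' = keys u,
          size (children u') = size (children u), cnt u <= cnt u'
        & forall i c, onth (children u) i = Some c ->
            exists2 c', onth (children u') i = Some c' & c <= c']
  | Inner _, _ => False
  | _, _ => y = x
  end.

Definition heap_ext h h' :=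
  forall a x, node_at h a = Some x ->
  exists2 y, node_at h' a = Some y & node_ext x y.

Definition agree (n : nat) G G' := forall a, a < n -> G' a = G a.

Lemma agree_trans n n' G1 G2 G3 :
  n <= n' -> agree n G1 G2 -> agree n' G2 G3 -> agree n G1 G3.
Proof. by move=> le12 a12 a23 a lt_a; rewrite a23 ?a12 //; apply: leq_trans
  le12. Qed.

Lemma onth_lt {T : Type} {s : seq T} {i x} : onth s i = Some x -> i < size s.
Proof. by move=> E; rewrite -onthTE E. Qed.

Lemma lt_onth {T : Type} {s : seq T} {i} :
  i < size s -> exists x, onth s i = Some x.
Proof. by rewrite -onthTE; case: (onth s i) => // x _; exists x. Qed.

Lemma node_at_lt h a x : node_at h a = Some x -> a < size h.
Proof. exact: onth_lt. Qed.

Lemma lt_node_at h a : a < size h -> exists x, node_at h a = Some x.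
Proof. exact: lt_onth. Qed.

Lemma child_inv h q i c : child h q i = Some c ->
  exists2 u, node_at h q = Some (Inner u) & onth (children u) i = Some c.
Proof.
rewrite /child; case E: (node_at h q) => [[| |u|]|] // Ec.
by exists u.
Qed.

Lemma child_inner h q u i :
  node_at h q = Some (Inner u) -> child h q i = onth (children u) i.
Proof. by rewrite /child => ->. Qed.

Lemma node_ext_refl x : node_ext x x.
Proof. by case: x => //= u; split=> // i c; exists c. Qed.

Lemma node_ext_trans y x z : node_ext x y -> node_ext y z -> node_ext x z.
Proof.
case: x => [|k v|u|t q i]; first by move=> ->.
- by move=> ->.
- case: y => // u' [e1 e2 e3 e4 e5]; case: z => // u'' [f1 f2 f3 f4 f5].
  split; try by etransitivity; eassumption.
  + exact: leq_trans f4.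
  + move=> i c /e5[c' /f5[c'' E l2] l1]; exists c'' => //.
    exact: leq_trans l2.
- by move=> ->.
Qed.

Lemma heap_ext_refl h : heap_ext h h.
Proof. by move=> a x E; exists x => //; apply: node_ext_refl. Qed.

Lemma heap_ext_trans h2 h1 h3 :
  heap_ext h1 h2 -> heap_ext h2 h3 -> heap_ext h1 h3.
Proof.
move=> e12 e23 a x /e12[y /e23[z Ez yz] xy]; exists z => //.
exact: node_ext_trans yz.
Qed.

Lemma heap_ext_size h h' : heap_ext h h' -> size h <= size h'.
Proof.
move=> e; case Es: (size h) => [//|n].
have /lt_node_at[x /e[y /node_at_lt lt _]] : n < size h by rewrite Es.
by [].
Qed.

Lemma heap_ext_cat h l : heap_ext h (h ++ l).
Proof.
move=> a x E; exists x; last exact: node_ext_refl.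
by rewrite /node_at onth_cat (node_at_lt E).
Qed.

Lemma heap_ext_rcons h x : heap_ext h (rcons h x).
Proof. by rewrite -cats1; apply: heap_ext_cat. Qed.

Section Mono.

Variables (h h' : heap).
Hypothesis ext : heap_ext h h'.

Lemma inner_ext a u : node_at h a = Some (Inner u) ->
  exists2 u', node_at h' a = Some (Inner u') & node_ext (Inner u) (Inner u').
Proof. by case/ext => -[| |u'|] // E; exists u'. Qed.

Lemma is_inner_ext a : is_inner h a -> is_inner h' a.
Proof. by case=> u /inner_ext[u' E _]; exists u'. Qed.

Lemma rebuild_ext a t q i : node_at h a = Some (Rebuild t q i) ->
  node_at h' a = Some (Rebuild t q i).
Proof. by case/ext => y E yE; rewrite E yE. Qed.

Lemma leaf_ext a x : node_at h a = Some x -> is_leaf x ->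
  node_at h' a = Some x.
Proof. by case/ext => y E; case: x => //= [|k v] E' _; rewrite E E'. Qed.

Lemma rebuild_ext_inv a t q i : a < size h ->
  node_at h' a = Some (Rebuild t q i) -> node_at h a = Some (Rebuild t q i).
Proof.
case/lt_node_at => x E; have [y E' xy] := ext E; rewrite E' => -[Ey].
by move: E xy; rewrite Ey; case: x => // t' q' i' E1 xy'; rewrite E1 xy'.
Qed.

Lemma inner_ext_inv a u' : a < size h -> node_at h' a = Some (Inner u') ->
  exists2 u, node_at h a = Some (Inner u) & node_ext (Inner u) (Inner u').
Proof.
case/lt_node_at => x E; have [y E' xy] := ext E; rewrite E' => -[Ey].
by move: E xy; rewrite Ey; case: x => // u; exists u.
Qed.

Lemma child_ext q i c : child h q i = Some c ->
  exists2 c', child h' q i = Some c' & c <= c'.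
Proof.
case/child_inv => u /inner_ext[u' E [_ _ _ _ e]] /e[c' E' le].
by exists c' => //; rewrite (child_inner _ E).
Qed.

Lemma child_ext_inv q i c' : q < size h -> child h' q i = Some c' ->
  exists2 c, child h q i = Some c & c <= c'.
Proof.
move=> lt_q /child_inv[u' /(inner_ext_inv lt_q)[u E [_ _ es _ e]] E'].
have := onth_lt E'; rewrite es => /lt_onth[c Ec].
exists c; first by rewrite (child_inner _ E).
by have [c'' ] := e _ _ Ec; rewrite E' => -[->].
Qed.

Variables (G G' : addr -> ghost).
Hypothesis agG : agree (size h) G G'.

Lemma belongs_ghost_ext q i g :
  belongs_ghost G h q i g -> belongs_ghost G' h' q i g.
Proof.
case=> e1 e2 e3 [u /[dup] /node_at_lt lt_q /inner_ext[u' E [_ ek _ _ _]] r].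
split=> //; first by rewrite agG.
by exists u' => // x; rewrite ek agG.
Qed.

Lemma belongs_ext q i c : belongs G h q i c -> belongs G' h' q i c.
Proof.
case=> lt_c c0 /belongs_ghost_ext b; split=> //; last by rewrite agG.
exact: leq_trans lt_c (heap_ext_size ext).
Qed.

Lemma placed_ext m : m < size h -> placed G h m -> placed G' h' m.
Proof.
move=> lt_m [c /child_ext[c' E le'] le]; exists c'; first by rewrite agG.
exact: leq_trans le'.
Qed.

Lemma detached_ext m : m < size h -> detached G h m -> detached G' h' m.
Proof.
move=> lt_m [m0 [c /child_ext[c' E le'] le]]; split=> //.
by exists c'; [rewrite agG | apply: leq_trans le'].
Qed.

Hypothesis closed : forall a, a < size h -> up (G a) < size h.

Lemma ancestor_lt j a : a < size h -> ancestor G j a < size h.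
Proof. by move=> lt_a; elim: j => //= j IH; apply: closed. Qed.

Lemma ancestor_ext j a : a < size h -> ancestor G' j a = ancestor G j a.
Proof.
by move=> lt_a; elim: j => //= j ->; rewrite agG //; apply: ancestor_lt.
Qed.

Lemma dead_ext a : a < size h -> dead G h a -> dead G' h' a.
Proof.
move=> lt_a [j d]; exists j; rewrite ancestor_ext //.
by apply: detached_ext => //; apply: ancestor_lt.
Qed.

Lemma node_ok_ext a x : node_at h a = Some x ->
  node_ok G h a x -> node_ok G' h' a x.
Proof.
move=> E; have lt_a := node_at_lt E.
case: x E => [|k v|u|t q i] E //=.
- by rewrite agG.
- case=> es cs ds; split=> // [i c /cs[b r]|/ds]; last exact: dead_ext.
  split; first exact: belongs_ext.
  by move=> t q j /rebuild_ext_inv; case: b => lt_c _ _ /(_ lt_c)/r.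
- case=> lt_t it bt pt ba; split=> //.
  + exact: is_inner_ext.
  + exact: belongs_ext.
  + by apply: placed_ext => //; apply: ltn_trans lt_a.
  + exact: belongs_ext.
Qed.

End Mono.

Lemma heap_ok_cat G G' h l :
  heap_ok G h -> agree (size h) G G' ->
  (forall a, size h <= a < size (h ++ l) -> up (G' a) < size (h ++ l)) ->
  (forall a x, size h <= a -> node_at (h ++ l) a = Some x ->
     node_ok G' (h ++ l) a x) ->
  heap_ok G' (h ++ l).
Proof.
case=> i0 u0 r0 clo ok ag clo' ok'.
have ex : heap_ext h (h ++ l) by apply: heap_ext_cat.
have lt0 : 0 < size h by case: i0 => u /node_at_lt.
split.
- exact: is_inner_ext i0.
- by rewrite ag.
- by move=> x; rewrite ag.
- move=> a lt_a; have [lt_ah|le_ha] := ltnP a (size h); last first.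
    by apply: clo'; rewrite le_ha.
  by rewrite ag // size_cat ltn_addr ?clo.
- move=> a x E; have [lt_ah|le_ha] := ltnP a (size h); last exact: ok'.
  have Ex : node_at h a = Some x by move: E; rewrite /node_at onth_cat lt_ah.
  by apply: (node_ok_ext ex ag clo Ex); apply: ok.
Qed.

Lemma node_at_update h n f u a : node_at h n = Some (Inner u) ->
  node_at (update h n f) a =
  if a == n then Some (Inner (f u)) else node_at h a.
Proof.
move=> E; rewrite /update E /node_at.
elim: h n a E => [|x h IH] [|n] [|a] //=; first by rewrite eqSS; apply: IH.
Qed.

Lemma size_update h n f : size (update h n f) = size h.
Proof.
rewrite /update; case E: (node_at h n) => [[| |u|]|] //.
by rewrite size_set_nth; apply/maxn_idPr/(node_at_lt E).
Qed.

Lemma update_id h n f : ~ is_inner h n -> update h n f = h.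
Proof.
rewrite /update => ni; case E: (node_at h n) => [[| |u|]|] //.
by case: ni; exists u.
Qed.

Lemma heap_ext_update h n f :
  (forall u, node_at h n = Some (Inner u) -> node_ext (Inner u) (Inner (f u)))
    ->
  heap_ext h (update h n f).
Proof.
move=> e; case: (pselect (is_inner h n)) => [[u E]|/update_id ->]; last first.
  exact: heap_ext_refl.
move=> a x Ea; rewrite (node_at_update _ _ E).
case: eqP => [Ean|_]; last by exists x => //; apply: node_ext_refl.
by exists (Inner (f u)) => //; move: Ea; rewrite Ean E => -[<-]; apply: e.
Qed.

Lemma heap_ok_update G h n f :
  heap_ok G h ->
  (forall u, node_at h n = Some (Inner u) ->
   [/\ node_ext (Inner u) (Inner (f u)),
       forall i c, onth (children (f u)) i = Some c ->
         belongs G h n i c /\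
         forall t q j, node_at h c = Some (Rebuild t q j) -> q = n /\ j = i
     & stat (f u) <> clean -> dead G h n]) ->
  heap_ok G (update h n f).
Proof.
move=> hok e; case: (pselect (is_inner h n)) => [[u E]|/update_id -> //].
have [e1 e2 e3] := e u E.
have ex : heap_ext h (update h n f).
  by apply: heap_ext_update => u'; rewrite E => -[<-].
have ag : agree (size h) G G by [].
case: hok => i0 u0 r0 clo ok.
split=> //.
- exact: is_inner_ext i0.
- by move=> a; rewrite size_update; apply: clo.
- move=> a x; rewrite (node_at_update _ _ E); case: eqP => [-> [<-]|_ Ex].
    case: e1 => _ ek es _ _; case: (ok _ _ E) => so _ _; split.
    + by rewrite es ek.
    + move=> i c /e2[b r]; split; first exact: (belongs_ext ex ag b).
      case: b => lt_c _ _ t q j /(rebuild_ext_inv ex lt_c); exact: r.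
    + by move/e3; apply: (dead_ext ex ag clo); apply: node_at_lt E.
  by apply: (node_ok_ext ex ag clo Ex); apply: ok.
Qed.

Lemma onth_set_nth (s : seq addr) i c j : i < size s ->
  onth (set_nth c s i c) j = if j == i then Some c else onth s j.
Proof. by elim: s i j => [|x s IH] [|i] [|j] //= /IH ->; rewrite eqSS. Qed.

Lemma child_set_child h n i c w q j : child h n i = Some c ->
  child (update h n (set_child i w)) q j =
  if (q == n) && (j == i) then Some w else child h q j.
Proof.
case/child_inv => u E Ec; rewrite /child (node_at_update _ _ E).
have [->|//] := eqVneq q n; rewrite E /= onth_set_nth //; exact: onth_lt Ec.
Qed.

Lemma ext_set_child h n i c w : child h n i = Some c -> c <= w ->
  heap_ext h (update h n (set_child i w)).
Proof.
move=> Ec le; apply: heap_ext_update => u E.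
have {}Ec : onth (children u) i = Some c by rewrite -(child_inner _ E).
split=> //=; first by rewrite size_set_nth; apply/maxn_idPr/(onth_lt Ec).
move=> j d Ed; rewrite onth_set_nth ?(onth_lt Ec) //.
by case: eqP Ed => [->|_ Ed]; [rewrite Ec => -[<-]; exists w | exists d].
Qed.

Lemma heap_ok_set_child G h n i c w :
  heap_ok G h -> child h n i = Some c -> c <= w -> belongs G h n i w ->
  (forall t q j, node_at h w = Some (Rebuild t q j) -> q = n /\ j = i) ->
  heap_ok G (update h n (set_child i w)).
Proof.
move=> hok Ec le bw rw; apply: heap_ok_update => // u E.
have Ec' : onth (children u) i = Some c by rewrite -(child_inner _ E).
case: hok => _ _ _ _ /(_ _ _ E)[so cs ds]; split=> //=.
- split=> //=; first by rewrite size_set_nth; apply/maxn_idPr/(onth_lt Ec').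
  move=> j d Ed; rewrite onth_set_nth ?(onth_lt Ec') //.
  by case: eqP Ed => [->|_ Ed]; [rewrite Ec' => -[<-]; exists w | exists d].
- move=> j d; rewrite onth_set_nth ?(onth_lt Ec') //.
  by case: eqP => [-> [<-]|_ /cs].
Qed.

Lemma node_ext_cas old new u :
  node_ext (Inner u) (Inner (if stat u == old then set_status new u else u)).
Proof. by case: eqP => _; split=> // i c; exists c. Qed.

Lemma ext_cas h n old new : heap_ext h (cas_status h n old new).
Proof. by apply: heap_ext_update => u _; apply: node_ext_cas. Qed.

Lemma heap_ok_cas G h n old new : heap_ok G h -> dead G h n ->
  heap_ok G (cas_status h n old new).
Proof.
move=> hok dn; apply: heap_ok_update => // u E; split=> //.
  exact: node_ext_cas.
case: hok => _ _ _ _ /(_ _ _ E)[so cs ds] i c.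
by case: eqP => _ /=; apply: cs.
Qed.

Lemma ext_incr h n : heap_ext h (fetch_and_add_count h n).
Proof.
by apply: heap_ext_update => u _; split=> // i c; exists c.
Qed.

Lemma heap_ok_incr G h n : heap_ok G h -> heap_ok G (fetch_and_add_count h n).
Proof.
move=> hok; apply: heap_ok_update => // u E.
by case: hok => _ _ _ _ /(_ _ _ E)[so cs ds]; split=> //; split=> // i c;
  exists c.
Qed.

End Invariants.

(** * Ideal trees *)

Section Ideal.

Implicit Types (G : addr -> ghost) (h : heap) (u : inner).

(** Stronger than [node_ok]: the slots of a new subtree hold no [Rebuild] node. Without further
    updates and rebuildings, such slots are therefore constant from their creation. *)
Definition fresh_ok G h a (x : node) : Prop :=
  match x with
  | Empty => True
  | Single k _ => rng (G a) k
  | Inner u =>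
      [/\ size (children u) = (size (keys u)).+1,
          forall i c, onth (children u) i = Some c ->
            belongs G h a i c /\ ~ is_rebuild h c
        & stat u = clean]
  | Rebuild _ _ _ => False
  end.

Lemma fresh_node_ok G h a x : fresh_ok G h a x -> node_ok G h a x.
Proof.
case: x => //= u [es cs st]; split=> // i c /cs[b nr]; split=> // t q j E.
by case: nr; exists t, q, j.
Qed.

Lemma fresh_ok_ext G G' h h' a x :
  heap_ext h h' -> agree (size h) G G' -> a < size h ->
  fresh_ok G h a x -> fresh_ok G' h' a x.
Proof.
move=> ex ag lt_a; case: x => //= [k v|u]; first by rewrite ag.
case=> es cs st; split=> // i c /cs[b nr]; split.
  exact: belongs_ext b.
case=> t [q [j /rebuild_ext_inv E]]; apply: nr; exists t, q, j.
by apply: E; case: b.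
Qed.

Definition fresh_heap G h h' :=
  forall b x, size h <= b -> node_at h' b = Some x -> fresh_ok G h' b x.

Lemma fresh_heap_cat G1 G2 h h1 l :
  heap_ext h h1 -> agree (size h1) G1 G2 -> fresh_heap G1 h h1 ->
  fresh_heap G2 h1 (h1 ++ l) -> fresh_heap G2 h (h1 ++ l).
Proof.
move=> ex ag f1 f2 b x le_b E.
have [lt_b|] := ltnP b (size h1); last by move=> /f2; apply.
have ex1 : heap_ext h1 (h1 ++ l) by apply: heap_ext_cat.
apply: (fresh_ok_ext ex1 ag) => //; apply: f1 => //.
by move: E; rewrite /node_at onth_cat lt_b.
Qed.

(** Children are allocated before their parent, so their ghosts must name an address that does not
    exist yet. Hence the ghost [g] of the top node is a parameter, and the top node is exempt from
    the closure of the heap under [up]; [ideals_spec] does the same for a row of siblings. *)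
Definition ideal_spec h (kvs : seq (K * V)) h' a :=
  0 < size h -> forall G (g : ghost), (forall k v i, onth kvs i = Some (k, v)
    -> rng g k) ->
  exists G', [/\ agree (size h) G G', G' a = g, size h <= a < size h',
    (exists l, h' = h ++ l) /\ ~ is_rebuild h' a
    & (forall b, size h <= b < size h' -> b <> a -> up (G' b) < size h') /\
      fresh_heap G' h h'].

Definition ideals_spec h (parts : seq (seq (K * V))) h' (cs : seq addr) :=
  0 < size h -> forall G (g : nat -> ghost),
  (forall j part, onth parts j = Some part ->
   forall k v i, onth part i = Some (k, v) -> rng (g j) k) ->
  exists G', [/\ agree (size h) G G',
    size cs = size parts,
    forall j c, onth cs j = Some c ->
      [/\ G' c = g j, size h <= c < size h' & ~ is_rebuild h' c],
    exists l, h' = h ++ l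
    & (forall b, size h <= b < size h' ->
         up (G' b) < size h' \/ exists j, G' b = g j) /\
      fresh_heap G' h h'].

Lemma node_at_rcons h x a y : node_at (rcons h x) a = Some y ->
  (a = size h /\ y = x) \/ (a < size h /\ node_at h a = Some y).
Proof.
rewrite -cats1 /node_at onth_cat; case: ltnP => [lt_a E|le_a]; first by right.
case E: (a - size h) => [|n] /=; last by rewrite onth0n.
by case=> <-; left; split=> //; lia.
Qed.

Lemma node_at_rcons_size h x : node_at (rcons h x) (size h) = Some x.
Proof. by rewrite /node_at -cats1 onth_cat ltnn subnn. Qed.

Lemma ideal_leaf h kvs x : is_leaf x ->
  (forall k v, x = Single k v -> kvs = [:: (k, v)]) ->
  ideal_spec h kvs (rcons h x) (size h).
Proof.
move=> lx ex h0 G g inr; exists (fun b => if b == size h then g else G b).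
split.
- by move=> b lt_b; case: eqP => // eb; rewrite eb ltnn in lt_b.
- by rewrite eqxx.
- by rewrite size_rcons leqnn ltnS leqnn.
- split; first by exists [:: x]; rewrite cats1.
  by case=> t [q [i]]; rewrite node_at_rcons_size => -[xE]; rewrite xE in lx.
- split; first by move=> b; rewrite size_rcons ltnS -eqn_leq => /eqP ->.
  move=> b y le_b /node_at_rcons[[-> ->]|[]]; last by rewrite ltnNge le_b.
  case: x lx ex => //= k v _ /(_ k v erefl) kE; rewrite eqxx.
  by apply: (inr k v 0); rewrite kE.
Qed.

Lemma onth_flatten {T : Type} (ss : seq (seq T)) j s i x :
  onth ss j = Some s -> onth s i = Some x ->
  exists n, onth (flatten ss) n = Some x.
Proof.
elim: ss j => [|s0 ss IH] [|j] //=.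
  by case=> -> E; exists i; rewrite onth_cat (onth_lt E).
move=> Ej Ei; have [n En] := IH _ Ej Ei.
exists (size s0 + n); rewrite onth_cat ifF ?addKn //.
by apply/negbTE; rewrite -leqNgt leq_addr.
Qed.

Lemma onth_all {T : Type} (P : pred T) s i x :
  all P s -> onth s i = Some x -> P x.
Proof.
elim: s i => [|y s IH] [|i] //= /andP[Py Ps]; first by case=> <-.
exact: IH.
Qed.

Lemma all_part {T : Type} (P : pred T) ss i s :
  all P (flatten ss) -> onth ss i = Some s -> all P s.
Proof.
elim: ss i => [|s0 ss IH] [|i] //=; rewrite all_cat => /andP[P0 Ps].
  by case=> <-.
exact: IH.
Qed.

Lemma new_ideal_spec h kvs h' a : new_ideal h kvs h' a -> ideal_spec h kvs h' a.
Proof.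
apply: (@new_ideal_mut _ _ _ ideal_spec ideals_spec).
- by move=> {}h; apply: ideal_leaf.
- by move=> {}h k v; apply: ideal_leaf => // k' v' [-> ->].
- move=> {}h {}h' {}kvs parts ks cs _ kE _ _ [sz srt sep] _ IH h0 G g inr.
  (* [size h'] is the address that the Inner node will receive once its children are allocated. *)
  pose gc j := Ghost (size h') j (dep g).+1
                 (fun x => rng g x /\ interpolation_search x ks = j).
  have [|G1 [ag szc csP [l hE] [clo fr]]] := IH h0 G gc.
    move=> j part Ej k v i Ei; split.
      rewrite kE in inr; have [n En] := onth_flatten Ej Ei.
      exact: inr En.
    by have /= /eqP := onth_all (sep _ _ Ej) Ei.
  have exh : heap_ext h h' by rewrite hE; apply: heap_ext_cat.
  set w := Inner _; have exr : heap_ext h' (rcons h' w).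
    exact: heap_ext_rcons.
  have le_h := heap_ext_size exh.
  pose G2 b := if b == size h' then g else G1 b.
  have ag2 : agree (size h') G1 G2.
    by move=> b lt_b; rewrite /G2 ifF //; apply/negbTE; lia.
  have frw : fresh_heap G2 h' (rcons h' w).
    move=> b y le_b /node_at_rcons[[-> ->]|[]]; last by rewrite ltnNge le_b.
    split=> //=; first by rewrite szc sz.
    move=> i c Ec; have [Gc /andP[le_c lt_c] nr] := csP _ _ Ec; split; last
      first.
      case=> t [q [j /(rebuild_ext_inv exr lt_c) E]].
      by apply: nr; exists t, q, j.
    split.
    - by rewrite size_rcons ltnS ltnW.
    - by lia.
    - rewrite /G2 ifF ?Gc; last by apply/negbTE; lia.
      split=> //=; first by rewrite eqxx.
      by eexists; [exact: node_at_rcons_size | rewrite eqxx].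
  exists G2; split.
  - exact: agree_trans ag ag2.
  - by rewrite /G2 eqxx.
  - by rewrite size_rcons ltnS leqnn andbT.
  - split; first by exists (rcons l w); rewrite hE rcons_cat.
    by case=> t [q [j]]; rewrite node_at_rcons_size.
  - split.
      move=> b /andP[le_b lt_b] nb; rewrite size_rcons in lt_b *.
      rewrite ag2; last by lia.
      by have [|lt_u|[j ->]] := clo b; [lia|lia|].
    rewrite -cats1; apply: (fresh_heap_cat exh ag2 fr).
    by rewrite cats1.
- move=> {}h h0 G g _; exists G; split=> //.
  + by move=> j c; rewrite onth0n.
  + by exists [::]; rewrite cats0.
  + split; first by move=> b; lia.
    by move=> b x le_b /node_at_lt; rewrite ltnNge le_b.
- move=> {}h h1 h2 part parts c cs _ IH1 _ IH2 h0 G g inr.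
  have [|G1 [ag1 Gc cP [[l1 h1E] nr] [clo1 fr1]]] := IH1 h0 G (g 0).
    exact: (inr 0).
  have [||G2 [ag2 szc csP [l2 h2E] [clo2 fr2]]] := IH2 _ G1 (fun j => g j.+1).
    by case/andP: cP => _; case: (size h1).
    by move=> j; apply: (inr j.+1).
  have ex1 : heap_ext h h1 by rewrite h1E; apply: heap_ext_cat.
  have ex2 : heap_ext h1 h2 by rewrite h2E; apply: heap_ext_cat.
  have le1 := heap_ext_size ex1; have le2 := heap_ext_size ex2.
  have [le_c lt_c] := andP cP.
  exists G2; split.
  + exact: agree_trans ag1 ag2.
  + by rewrite /= szc.
  + case=> [|j] d /=; last by case/csP => -> ? ?; split=> //; lia.
    case=> <-; split; [by rewrite ag2|lia|].
    case=> t [q [j /(rebuild_ext_inv ex2 lt_c) E]].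
    by apply: nr; exists t, q, j.
  + by exists (l1 ++ l2); rewrite h2E h1E catA.
  + split.
      move=> b /andP[le_b lt_b]; have [lt_b1|le_b1] := ltnP b (size h1).
        rewrite ag2 //; have [->|nb] := eqVneq b c; first by right; exists 0.
        left; apply: leq_trans le2; apply: clo1; [lia|exact/eqP].
      by have [|lt_u|[j ->]] := clo2 b; [lia|by left|by right; exists j.+1].
    rewrite h2E; apply: (fresh_heap_cat ex1 ag2 fr1).
    by rewrite -h2E.
Qed.

(** * Existence of ideal trees on strictly increasing keys *)

(** With s the floor of the square root, s^2 <= n <= s^2 + 2s. If n < s^2 + s, there are s parts, n
    - s^2 of them of size s + 1 and the others of size s; otherwise there are s + 1 parts, n - (s^2
    + s) of them of size s + 1. The bound [m < n] serves the recursion. *)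
Lemma near_sqrt_shape n : 2 <= n ->
  exists2 sh, sumn sh = n &
    near_sqrt n (size sh) /\ all (fun m => near_sqrt n m && (0 < m < n)) sh.
Proof.
move=> n2; rewrite /near_sqrt; set s := PeanoNat.Nat.sqrt n.
have [s1 s2] : s * s <= n /\ n < s.+1 * s.+1.
  by have := PeanoNat.Nat.sqrt_spec' n; rewrite -/s; lia.
have s_gt0 : 0 < s by case: (posnP s) s2 => // ->; lia.
have [eqn|neq] := eqVneq n (s * s).
  exists (nseq s s); first by rewrite sumn_nseq eqn.
  rewrite size_nseq eqxx; split=> //; apply/allP => m /nseqP[-> _].
  by rewrite eqxx /=; nia.
have up : PeanoNat.Nat.sqrt_up n = s.+1.
  by apply: PeanoNat.Nat.sqrt_up_unique; simpl; nia.
rewrite up.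
have sumn2 a b : sumn (nseq a s ++ nseq b s.+1) = a * s + b * s.+1.
  by rewrite sumn_cat !sumn_nseq mulnC [b * _]mulnC.
have [lt|le] := ltnP n (s * s + s).
  exists (nseq (s - (n - s * s)) s ++ nseq (n - s * s) s.+1).
    by rewrite sumn2; nia.
  rewrite size_cat !size_nseq; split; first by apply/orP; left; apply/eqP; lia.
  rewrite all_cat; apply/andP; split; apply/allP => m /nseqP[-> _];
    rewrite eqxx ?orbT /=; nia.
exists (nseq (s.+1 - (n - (s * s + s))) s ++ nseq (n - (s * s + s)) s.+1).
  by rewrite sumn2; nia.
rewrite size_cat !size_nseq; split.
  by apply/orP; right; apply/eqP; nia.
(* For n = 2 the block of parts of size [s.+1] is empty; that it is not, by [m0], is what gives
   [s.+1 < n]. *)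
rewrite all_cat; apply/andP; split; apply/allP => m /nseqP[-> m0];
  rewrite eqxx ?orbT /=; nia.
Qed.

Definition key_lt (a b : K * V) := (a.1 < b.1)%O.

(** The separators are the first keys of all the parts but the first. The clause on predicates [P]
    carries bounds on the later keys over to the separators, which makes them sorted in the
    induction. *)
Lemma separators_exist (parts : seq (seq (K * V))) :
  0 < size parts -> all (fun p => 0 < size p) parts ->
  pairwise key_lt (flatten parts) ->
  exists2 ks, separated ks parts &
    forall P : pred K, all (fun kv => P kv.1) (flatten (behead parts)) ->
      all P ks.
Proof.
elim: parts => [//|p [|[|[k1 v1] p1] rest] IH] _ /=.
- move=> _ _; exists [::] => //; split=> // -[|i] part /=; last by rewrite
    onth0n.
  by case=> <-; apply: (@sub_all _ predT); last exact: all_predT.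
- by rewrite andbF.
case/andP => p_gt0 rest_gt0; rewrite pairwise_cat.
case/and3P => ltp _ srt; have /andP[lt1 _] := srt.
have [//||//|ks [sz sk sep] ksP] := IH; first by rewrite /= rest_gt0.
exists (k1 :: ks); last first.
  move=> P /=/andP[-> ]; rewrite all_cat => /andP[_ aP] /=; exact: ksP.
split; first by rewrite /= -sz.
  rewrite /= path_min_sorted //; apply: ksP.
  by move: lt1; rewrite all_cat => /andP[].
case=> [|i] part /=.
  case=> <-; move: ltp; rewrite /allrel.
  apply: sub_all => -[k v] /= /andP[lt_k _].
  by rewrite /interpolation_search /= (_ : (k < k1)%O).
move=> Ei; have := sep _ _ Ei.
have ge1 : all (fun kv => (k1 <= kv.1)%O) part.
  have : all (fun kv : K * V => (k1 <= kv.1)%O) (flatten (((k1, v1) :: p1) ::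
    rest)).
    by rewrite /= lexx; apply: sub_all lt1 => kv /ltW.
  by move=> a; apply: all_part a Ei.
move=> a; have := conj ge1 a; move/andP; rewrite -all_predI.
apply: sub_all => -[k v] /= /andP[le1 /eqP <-].
by rewrite /interpolation_search /= ltNge le1.
Qed.

(** This is what keeps [createIdeal] from blocking at its allocation. Induction on a bound of the
    size, as each part is strictly smaller than the whole. *)
Lemma new_ideal_exists (h : heap) kvs : pairwise key_lt kvs ->
  exists h' a, new_ideal h kvs h' a.
Proof.
move: {2}(size kvs) (leqnn (size kvs)) => n.
elim: n h kvs => [|n IH] h [|[k v] kvs] //=.
- by move=> _ _; eexists; eexists; apply: NewIdealEmpty.
- by move=> _ _; eexists; eexists; apply: NewIdealEmpty.
rewrite ltnS => sz; case Ekvs: kvs => [|kv kvs'].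
  by move=> _; eexists; eexists; apply: NewIdealSingle.
rewrite -Ekvs -[_ && _]/(pairwise key_lt ((k, v) :: kvs)) => srt.
set l := _ :: kvs in srt *.
have n2 : 1 < size l by rewrite /l Ekvs.
have szl : size l <= n.+1 by [].
have [sh sumsh [nsh /allP ash]] := near_sqrt_shape n2.
have shp : shape (reshape sh l) = sh by apply: reshapeKl; rewrite sumsh.
have fl : flatten (reshape sh l) = l by apply: reshapeKr; rewrite sumsh.
have szr : size (reshape sh l) = size sh by rewrite -[in RHS]shp size_map.
have part_lt : all (fun p => 0 < size p < size l) (reshape sh l).
  rewrite -(all_map size (fun m => 0 < m < size l)) -[map _ _]/(shape _) shp.
  by apply/allP => m /ash/andP[].
have [|||ks sepks _] := @separators_exist (reshape sh l).
- rewrite szr; case: (sh) sumsh => //= E; by rewrite -E in n2.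
- by apply: sub_all part_lt => p /andP[].
- by rewrite fl.
have news : forall parts h0, all (fun p => 0 < size p < size l) parts ->
    pairwise key_lt (flatten parts) -> exists h' cs, new_ideals h0 parts h' cs.
  elim=> [|p parts IHp] h0 /=.
    by move=> _ _; exists h0, [::]; apply: NewIdealsNil.
  case/andP => lt_p ap; rewrite pairwise_cat => /and3P[_ sp sps].
  have [|h1 [a E1]] := IH h0 p _ sp; first by lia.
  have [h2 [cs E2]] := IHp h1 ap sps.
  by exists h2, (a :: cs); apply: NewIdealsCons E1 E2.
have [|h' [cs E]] := news (reshape sh l) h part_lt; first by rewrite fl.
eexists; eexists; apply: (NewIdealInner n2 (esym fl) _ _ sepks E).
  by rewrite szr.
rewrite -[map _ _]/(shape _) shp; apply/allP => m /ash/andP[] //.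
Qed.

End Ideal.

Context {F : realType} (R : F).

(** * Thread invariants *)

Section Threads.

Implicit Types (G : addr -> ghost) (h : heap) (u : inner) (o : operation).

(** Consecutive nodes are linked by their homes and not by the current slots: a node of the path may
    have been replaced since it was visited. *)
Fixpoint chain G h (q : addr) (ns : tree_path) : Prop :=
  if ns is (m, j) :: r then
    [/\ belongs G h q j m, is_inner h m, placed G h m & chain G h m r]
  else True.

Definition path_end (q : addr) (ns : tree_path) : addr := last q (unzip1 ns).

Definition frame_ok G h (a : addr) (i : nat) :=
  exists2 u, node_at h a = Some (Inner u) & i < degree u /\ dead G h a.

Fixpoint frames_ok G h (stk : seq frame) : Prop :=
  if stk is (a, i, _) :: r then frame_ok G h a i /\ frames_ok G h r else True.

Definition mark_ok G h (m : mark_pc) : Prop :=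
  match m with
  | MarkCall a stk =>
      [/\ a < size h, dead G h a,
          forall t q i, node_at h a = Some (Rebuild t q i) -> dead G h t
        & frames_ok G h stk]
  | MarkLoop a i _ stk =>
      (exists2 u, node_at h a = Some (Inner u) & i <= degree u /\ dead G h a)
      /\ frames_ok G h stk
  | MarkStatus c a i _ stk =>
      [/\ is_inner h c, dead G h c, frame_ok G h a i & frames_ok G h stk]
  | MarkReturn _ stk => frames_ok G h stk
  end.

(* The frames of the traversal are nested: the keys [P] of what lies above a
   frame come from its children of index less than [j].  The pairs collected so
   far precede all the keys of the remaining children. *)
Fixpoint collect_frames G h (t : addr) (P : K -> Prop)
    (stk : seq (addr * nat)) (kvs : seq (K * V)) : Prop :=
  if stk is (a, j) :: r then
    exists2 u, node_at h a = Some (Inner u) &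
    [/\ j <= degree u,
        forall y, P y -> rng (G a) y /\ interpolation_search y (keys u) < j,
        forall y, rng (G a) y -> j <= interpolation_search y (keys u) ->
          all (fun kv => (kv.1 < y)%O) kvs,
        forall y, rng (G a) y -> rng (G t) y
      & collect_frames G h t (rng (G a)) r kvs]
  else True.

Definition keys_in (P : K -> Prop) (kvs : seq (K * V)) :=
  forall k v i, onth kvs i = Some (k, v) -> P k.

Definition collect_ok G h (t : addr) (c : collect_pc) : Prop :=
  match c with
  | Visit a stk kvs =>
      [/\ a < size h, pairwise key_lt kvs, keys_in (rng (G t)) kvs,
          forall y, rng (G a) y ->
            rng (G t) y /\ all (fun kv => (kv.1 < y)%O) kvs
        & collect_frames G h t (rng (G a)) stk kvs]
  | Collect stk kvs =>
      [/\ pairwise key_lt kvs, keys_in (rng (G t)) kvs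
        & collect_frames G h t (fun _ => False) stk kvs]
  end.

Definition help_ok G h (op : addr) (s : help_pc) : Prop :=
  exists t q i, [/\ node_at h op = Some (Rebuild t q i), dead G h t &
    match s with
    | HelpStart => True
    | HelpMark m => mark_ok G h m
    | HelpCreate _ c => collect_ok G h t c
    | Install a => [/\ belongs G h q i a, op < a & ~ is_rebuild h a]
    | HelpDone => True
    end].

Definition thread_ok G h o (s : pc) : Prop :=
  match s with
  | Descend ns n =>
      [/\ is_update o, chain G h 0 ns, n = path_end 0 ns, is_inner h n
        & rng (G n) (op_key o)]
  | Update ns n i c =>
      [/\ is_update o, chain G h 0 ns, n = path_end 0 ns
        & [/\ is_inner h n, belongs G h n i c,
              exists2 x, node_at h c = Some x & is_leaf x
            & rng (G c) (op_key o)]]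
  | IncrCounts _ ns => is_update o /\ chain G h 0 ns
  | CheckCounts q todo => is_update o /\ chain G h q todo
  | StartRebuild a q i => is_update o /\ chain G h q [:: (a, i)]
  | Help op _ s' => is_update o /\ help_ok G h op s'
  | Search a => is_lookup o /\ a < size h
  | Return _ => True
  end.

Section Mono.

Variables (G G' : addr -> ghost) (h h' : heap).
Hypotheses (ext : heap_ext h h') (agG : agree (size h) G G').
Hypothesis closed : forall a, a < size h -> up (G a) < size h.

Let le_size : size h <= size h' := heap_ext_size ext.

Lemma chain_ext q ns : chain G h q ns -> chain G' h' q ns.
Proof.
elim: ns q => [//|[m j] r IH] q /= [b i p c]; split.
- exact: belongs_ext b.
- exact: is_inner_ext i.
- by apply: (placed_ext ext agG) p; case: b.
- exact: IH.
Qed.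

Lemma frame_ok_ext a i : frame_ok G h a i -> frame_ok G' h' a i.
Proof.
case=> u E [lt d]; have [u' E' [_ _ e _ _]] := inner_ext ext E.
exists u' => //; rewrite /degree e; split=> //.
by apply: (dead_ext ext agG closed _ d); apply: node_at_lt E.
Qed.

Lemma frames_ok_ext stk : frames_ok G h stk -> frames_ok G' h' stk.
Proof. by elim: stk => [//|[[a i] n] r IH] /= [/frame_ok_ext f /IH]. Qed.

Lemma mark_ok_ext m : (forall a t q i, node_at h a = Some (Rebuild t q i) -> t
  < size h) ->
  mark_ok G h m -> mark_ok G' h' m.
Proof.
move=> tlt.
have dE a : a < size h -> dead G h a -> dead G' h' a.
  exact: (dead_ext ext agG closed).
case: m => [a stk|a i n stk|c a i n stk|n stk] /=; last exact: frames_ok_ext.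
- case=> lt d dt f; split; [exact: leq_trans le_size|exact: dE| |].
    move=> t q i /(rebuild_ext_inv ext lt) E.
    by apply: dE (dt _ _ _ E); apply: tlt E.
  exact: frames_ok_ext.
- case=> -[u E [lt d]] f; split; last exact: frames_ok_ext.
  have [u' E' [_ _ e _ _]] := inner_ext ext E.
  exists u' => //; rewrite /degree e; split=> //.
  by apply: dE d; apply: node_at_lt E.
- case=> ic d f fs; split; [exact: is_inner_ext ic| |exact: frame_ok_ext|].
    by apply: dE d; case: ic => u /node_at_lt.
  exact: frames_ok_ext.
Qed.

Lemma collect_frames_ext t (P P' : K -> Prop) stk kvs :
  t < size h -> (forall y, P' y -> P y) ->
  collect_frames G h t P stk kvs -> collect_frames G' h' t P' stk kvs.
Proof.
move=> lt_t; elim: stk P P' => [//|[a j] r IH] P P' PP /= [u E].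
have [u' E' [_ ek es _ _]] := inner_ext ext E.
have lt_a := node_at_lt E.
rewrite !agG // => -[le pr lt sub cf]; exists u' => //.
rewrite /degree es ek; split=> //; first by move=> y /PP/pr.
exact: IH cf.
Qed.

Lemma collect_ok_ext t c : t < size h ->
  collect_ok G h t c -> collect_ok G' h' t c.
Proof.
move=> lt_t; case: c => [a stk kvs|stk kvs] /=.
  case=> lt srt ki al cf; split=> //; rewrite ?agG //.
    exact: leq_trans le_size.
  exact: collect_frames_ext cf.
by case=> srt ki cf; split; rewrite ?agG //; apply: collect_frames_ext cf.
Qed.

Lemma help_ok_ext op s : (forall a t q i, node_at h a = Some (Rebuild t q i) ->
  t < size h) ->
  help_ok G h op s -> help_ok G' h' op s.
Proof.
move=> tlt [t [q [i [E d ok]]]]; have lt_t := tlt _ _ _ _ E.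
exists t, q, i; split; first exact: rebuild_ext E.
  exact: (dead_ext ext agG closed lt_t d).
case: s ok => [//|m|n c|a|//].
- exact: mark_ok_ext.
- exact: collect_ok_ext.
- case=> b lt nr; split=> //; first exact: belongs_ext b.
  case: b => lt_a _ _ [t' [q' [i' /(rebuild_ext_inv ext lt_a) E']]].
  by apply: nr; exists t', q', i'.
Qed.

Lemma belongs_lt q i c : belongs G h q i c -> c < size h.
Proof. by case. Qed.

Lemma is_inner_lt a : is_inner h a -> a < size h.
Proof. by case=> u /node_at_lt. Qed.

Lemma thread_ok_ext o s : (forall a t q i, node_at h a = Some (Rebuild t q i)
  -> t < size h) ->
  thread_ok G h o s -> thread_ok G' h' o s.
Proof.
move=> tlt; case: s => [ns n|ns n i c|todo ns|q todo|a q i|op k s|a|r] //=.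
- case=> uo ch en inn rn; split=> //; [exact: chain_ext|exact: is_inner_ext
    inn|].
  by rewrite agG //; apply: is_inner_lt.
- case=> uo ch en [inn b [x Ex lx] rc]; split=> //; first exact: chain_ext.
  split; [exact: is_inner_ext inn|exact: belongs_ext b| |].
    by exists x => //; apply: leaf_ext Ex lx.
  by rewrite agG //; apply: belongs_lt b.
- by case=> uo ch; split=> //; apply: chain_ext.
- by case=> uo ch; split=> //; apply: chain_ext.
- case=> uo [b inn p _]; split=> //; split=> //.
  + exact: belongs_ext b.
  + exact: is_inner_ext inn.
  + by apply: (placed_ext ext agG) p; apply: belongs_lt b.
- by case=> uo ok; split=> //; apply: help_ok_ext.
- by case=> lo lt; split=> //; apply: leq_trans le_size.
Qed.

End Mono.

Section Facts.

Variables (G : addr -> ghost) (h : heap).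
Hypothesis hok : heap_ok G h.

Lemma heap_closed a : a < size h -> up (G a) < size h.
Proof. by case: hok => _ _ _ clo _; apply: clo. Qed.

Lemma heap_size_gt0 : 0 < size h.
Proof. by case: hok => -[u /node_at_lt]. Qed.

Lemma node_okP a x : node_at h a = Some x -> node_ok G h a x.
Proof. by case: hok => _ _ _ _; apply. Qed.

Lemma rebuild_lt a t q i : node_at h a = Some (Rebuild t q i) -> t < size h.
Proof.
by move=> E; case: (node_okP E) => lt _ _ _ _; apply: ltn_trans (node_at_lt E).
Qed.

Lemma child_belongs a i c : child h a i = Some c -> belongs G h a i c.
Proof. by case/child_inv => u /node_okP[_ cs _] /cs[]. Qed.

Lemma child_rebuild a i c t q j : child h a i = Some c ->
  node_at h c = Some (Rebuild t q j) -> q = a /\ j = i.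
Proof. by case/child_inv => u /node_okP[_ cs _] /cs[_ r] /r. Qed.

Lemma child_placed a i c : child h a i = Some c -> placed G h c.
Proof.
by move=> Ec; case: (child_belongs Ec) => _ _ [eu ei _ _]; exists c; rewrite
  ?eu ?ei.
Qed.

Lemma dead_up a : dead G h (up (G a)) -> dead G h a.
Proof. by case=> j d; exists j.+1; rewrite /ancestor iterSr. Qed.

Lemma dead_belongs a i c : belongs G h a i c -> dead G h a -> dead G h c.
Proof. by case=> _ _ [<- _ _ _]; apply: dead_up. Qed.

Lemma dead_detached a : detached G h a -> dead G h a.
Proof. by exists 0. Qed.

Lemma placed_detached a q i : belongs G h q i a -> placed G h a ->
  child h q i <> Some a -> detached G h a.
Proof.
case=> _ a0 [eu ei _ _] [c Ec le] ne; split=> //; exists c => //.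
rewrite ltn_neqAle le andbT; apply: contra_notN ne => /eqP ->.
by rewrite -eu -ei.
Qed.

Lemma rebuild_target_detached q i op t : child h q i = Some op ->
  node_at h op = Some (Rebuild t q i) -> detached G h t.
Proof.
move=> Ec E; case: (node_okP E) => lt _ b p _.
apply: (placed_detached b p); rewrite Ec => -[e].
by rewrite e ltnn in lt.
Qed.

Lemma root_not_dead : ~ dead G h 0.
Proof.
case: hok => _ u0 _ _ _ [j [nz _]]; apply: nz.
by elim: j => //= j ->.
Qed.

Lemma chain_rcons q ns m j : chain G h q ns -> belongs G h (path_end q ns) j m
  ->
  is_inner h m -> placed G h m -> chain G h q (rcons ns (m, j)).
Proof.
elim: ns q => [|[m' j'] r IH] q /=; first by [].
by case=> b i p c b1 i1 p1; split=> //; apply: IH.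
Qed.

End Facts.

Lemma path_end_rcons q ns m j : path_end q (rcons ns (m, j)) = m.
Proof. by rewrite /path_end /unzip1 map_rcons last_rcons. Qed.

(** The top of the new tree inherits the ghost of [c], hence its home and its set of keys. *)
Lemma heap_ok_ideal G h kvs h' a c q i :
  heap_ok G h -> belongs G h q i c -> keys_in (rng (G c)) kvs ->
  new_ideal h kvs h' a ->
  exists G', [/\ agree (size h) G G', heap_ext h h', heap_ok G' h',
    belongs G' h' q i a & size h <= a /\ ~ is_rebuild h' a].
Proof.
move=> hok [lt_c c0 bg] ki nid.
have sp := new_ideal_spec nid (heap_size_gt0 hok).
have [G' [ag Ga /andP[le_a lt_a] [[l hE] nr] [clo fr]]] := sp G (G c) ki.
have ex : heap_ext h h' by rewrite hE; apply: heap_ext_cat.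
exists G'; split=> //.
  rewrite {}hE in lt_a clo fr *; apply: (heap_ok_cat hok ag).
    move=> b lt_b; have [->|nb] := eqVneq b a; last by apply: clo => //;
      apply/eqP.
    rewrite Ga; case: bg => -> _ _ [u /node_at_lt lt_q _].
    by rewrite size_cat ltn_addr.
  by move=> b x le_b E; apply/fresh_node_ok/fr.
split=> //; first by move=> a0; have := heap_size_gt0 hok; rewrite a0 in le_a;
  lia.
by rewrite Ga; apply: (belongs_ghost_ext ex ag).
Qed.

(** The node of degree 2 made by an insertion is an ideal tree on two pairs. All the nodes created
    by updates thus fall under the specification of ideal trees. *)
Lemma new_pair_ideal h k1 v1 k2 v2 : (k1 < k2)%O ->
  new_ideal h [:: (k1, v1); (k2, v2)] (new_pair h k1 v1 k2 v2).1
    (new_pair h k1 v1 k2 v2).2.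
Proof.
move=> lt; rewrite /new_pair /=.
have -> : h ++ [:: Single k1 v1; Single k2 v2;
      Inner (MkInner 2 [:: k2] [:: size h; (size h).+1] clean 0)] =
   rcons (rcons (rcons h (Single k1 v1)) (Single k2 v2))
      (Inner (MkInner 2 [:: k2] [:: size h; (size h).+1] clean 0)).
  by rewrite -!cats1 -!catA.
set h2 := rcons (rcons h _) _.
have -> : (size h).+2 = size h2 by rewrite /h2 !size_rcons.
apply: (NewIdealInner (parts := [:: [:: (k1, v1)]; [:: (k2, v2)]])) => //.
  split=> // -[|[|i]] part //=; last by rewrite onth0n.
    by case=> <-; rewrite /= /interpolation_search /= lt.
  by case=> <-; rewrite /= /interpolation_search /= ltxx.
apply: NewIdealsCons; first exact: NewIdealSingle.
apply: NewIdealsCons; last exact: NewIdealsNil.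
rewrite -(size_rcons h (Single k1 v1)); exact: NewIdealSingle.
Qed.

Lemma new_replacement_ideal G h o c x h1 r : heap_ok G h ->
  node_at h c = Some x -> rng (G c) (op_key o) ->
  new_replacement h o x = Some (h1, r) ->
  exists2 kvs, new_ideal h kvs h1 r & keys_in (rng (G c)) kvs.
Proof.
move=> hok Ex rk.
have ki1 k v : rng (G c) k -> keys_in (rng (G c)) [:: (k, v)].
  by move=> r1 k' v' [|i] //=; [case=> <- _ | rewrite onth0n].
have ki2 k1 v1 k2 v2 : rng (G c) k1 -> rng (G c) k2 ->
    keys_in (rng (G c)) [:: (k1, v1); (k2, v2)].
  by move=> r1 r2 k' v' [|[|i]] //=; [case=> <- _|case=> <- _|rewrite onth0n].
have pair k1 v1 k2 v2 : rng (G c) k1 -> rng (G c) k2 -> (k1 < k2)%O ->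
    exists2 kvs, new_ideal h kvs (new_pair h k1 v1 k2 v2).1
      (new_pair h k1 v1 k2 v2).2 & keys_in (rng (G c)) kvs.
  move=> r1 r2 lt; exists [:: (k1, v1); (k2, v2)]; last exact: ki2.
  exact: new_pair_ideal.
case: o rk => [k v|k|//] /= rk; case: x Ex => [|k' v'|//|//] Ex //.
- by case=> <- <-; exists [:: (k, v)]; [apply: NewIdealSingle|apply: ki1].
- have rk' := node_okP hok Ex; case: eqP => [_ [<- <-]|/eqP nk].
    by exists [:: (k, v)]; [apply: NewIdealSingle|apply: ki1].
  case: ifP => [lt|/negbT ge] [<- <-]; first exact: (pair k' v' k v).
  by apply: (pair k v k' v') => //; rewrite lt_neqAle eq_sym nk leNgt.
- case: eqP => // _ [<- <-]; exists [::]; first exact: NewIdealEmpty.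
  by move=> k1 v1 i; rewrite onth0n.
Qed.

Lemma dcss_ext h n i c w y st r h' : dcss h n i c w y st r h' -> c <= w ->
  heap_ext h h'.
Proof.
by case=> // *; [apply: ext_set_child; eassumption|apply: heap_ext_refl..].
Qed.

Lemma dcss_ok G h n i c w y st r h' : heap_ok G h ->
  dcss h n i c w y st r h' -> c <= w -> belongs G h n i w ->
  (forall t q j, node_at h w = Some (Rebuild t q j) -> q = n /\ j = i) ->
  heap_ok G h'.
Proof.
by move=> hok; case=> // Ec _ le b rw; apply: heap_ok_set_child hok Ec le b rw.
Qed.

Lemma interp_le (x : K) (ks : seq K) : interpolation_search x ks <= size ks.
Proof. exact: find_size. Qed.

Lemma interp_lt_key (x y : K) ks :
  interpolation_search x ks < interpolation_search y ks -> (x < y)%O.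
Proof.
rewrite /interpolation_search => lt; have lt' := leq_trans lt (find_size _ _).
have has_x : has (fun z => (x < z)%O) ks by rewrite has_find.
have := nth_find x has_x.
have := before_find x lt.
set z := nth x ks _ => /negbT; rewrite -leNgt => le_zy lt_xz.
exact: lt_le_trans le_zy.
Qed.

(** * Preservation of the invariants by the steps *)

(** Marking never leaves the dead nodes: deadness passes from a node to whatever its slots hold, and
    a [Rebuild] found in a slot has its target at home in the same slot. *)
Lemma mark_step_ok G h m h' m' : heap_ok G h -> mark_ok G h m ->
  mark_step h m h' m' -> [/\ heap_ext h h', heap_ok G h' & mark_ok G h' m'].
Proof.
move=> hok + st.
have ag : agree (size h) G G by [].
have tlt := rebuild_lt hok.
have clo := heap_closed hok.
have lift h2 m2 : mark_ok G h m2 -> heap_ext h h2 -> heap_ok G h2 ->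
    [/\ heap_ext h h2, heap_ok G h2 & mark_ok G h2 m2].
  by move=> mo ex ok2; split=> //; apply: mark_ok_ext mo.
case: st => [a stk E|a stk k v E|a stk t q i E|a stk w E
  |a i n stk c Ec E|a i n stk c k v Ec E|a i n stk c t q j Ec E|a i n stk c w
    Ec E
  |c a i n stk m1 b E|c a i n stk m1 b E|a n stk w E|m1 a i n stk] mo;
  apply: lift; try (exact: heap_ext_refl); try exact: hok;
  try (exact: ext_cas); move: mo => /= mo.
- by case: mo.
- by case: mo.
- case: mo => _ _ /(_ _ _ _ E) d f; split=> //; first exact: tlt E.
  move=> t' q' i' E'; case: (node_okP hok E) => _ [u Eu] _ _ _.
  by rewrite Eu in E'.
- by case: mo => lt d _ f; split=> //; exists w.
- by case: mo => lt d _ f; apply: heap_ok_cas.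
- case: mo => -[u Eu [le d]] f; split=> //; exists u => //; split=> //.
  by move: Ec; rewrite (child_inner _ Eu) => /onth_lt.
- case: mo => -[u Eu [le d]] f; split=> //; exists u => //; split=> //.
  by move: Ec; rewrite (child_inner _ Eu) => /onth_lt.
- case: mo => -[u Eu [le d]] f.
  have b := child_belongs hok Ec; have dc := dead_belongs b d.
  have [eq ej] := child_rebuild hok Ec E; rewrite {}eq {}ej in E.
  split=> //; first exact: belongs_lt b.
    move=> t' q' i'; rewrite E => -[<- _ _].
    by case: (node_okP hok E) => _ _ bt _ _; apply: dead_belongs bt d.
  split=> //; exists u => //; split=> //.
  by move: Ec; rewrite (child_inner _ Eu) => /onth_lt.
- case: mo => -[u Eu [le d]] f.
  have b := child_belongs hok Ec; have dc := dead_belongs b d.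
  split=> //; first by exists w.
  exists u => //; split=> //.
  by move: Ec; rewrite (child_inner _ Eu) => /onth_lt.
- case: mo => ic d [u Eu [lt du]] f; split=> //.
  by exists u.
- case: mo => -[u Eu] d fr f; split=> //; first exact: node_at_lt Eu.
  by move=> t q j; rewrite Eu.
- by case: mo.
- by case: mo => -[u Eu [le d]] f; apply: heap_ok_cas.
- case: mo => -[u Eu [lt d]] f; split=> //; by exists u.
Qed.

Lemma collect_frames_weaken G h t P P' stk kvs :
  (forall y, P' y -> P y) ->
  collect_frames G h t P stk kvs -> collect_frames G h t P' stk kvs.
Proof.
case: stk => [//|[a j] r] PP [u E [le pr al sub cf]].
by exists u => //; split=> // y /PP/pr.
Qed.

(** In every frame the new key [k] comes from a child of index less than [j], so it precedes the
    keys of the children still to be visited. *)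
Lemma collect_frames_rcons G h t (P : K -> Prop) stk kvs k v : P k ->
  collect_frames G h t P stk kvs ->
  collect_frames G h t P stk (rcons kvs (k, v)).
Proof.
elim: stk P => [//|[a j] r IH] P Pk [u E [le pr al sub cf]].
have [rk ik] := pr _ Pk; exists u => //; split=> //; last exact: IH.
move=> y ry ij; rewrite all_rcons al // andbT /=.
exact: interp_lt_key (leq_trans ik ij).
Qed.

(** The slots may change during the traversal, but whatever is read in slot [i] of a node carries
    the keys reserved for this slot. A [Rebuild] node and its target have the same keys. *)
Lemma collect_step_ok G h t c c' : heap_ok G h ->
  collect_ok G h t c -> collect_step h c c' -> collect_ok G h t c'.
Proof.
move=> hok + st.
case: st => [a stk kvs E|a stk kvs k v E|a stk kvs t' q i E|a stk kvs w E
  |a i stk kvs c1 Ec|a stk kvs w E] /=.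
- by case=> lt srt ki al cf; split=> //; apply: collect_frames_weaken cf.
- case=> lt srt ki al cf; have rk := node_okP hok E.
  have [rt alk] := al _ rk; split.
  + by rewrite pairwise_rcons srt andbT.
  + move=> k' v' i; rewrite -cats1 onth_cat; case: ltnP => _; first exact: ki.
    by case: (i - _) => [|n] /=; [case=> <- _ | rewrite onth0n].
  + apply: collect_frames_weaken (collect_frames_rcons _ rk cf) => y [].
- case=> lt srt ki al cf; case: (node_okP hok E) => _ _ [lt' _ bt] _ [_ _ ba].
  have rE y : rng (G t') y -> rng (G a) y.
    case: bt => _ _ _ [u Eu r] /r; case: ba => _ _ _ [u' Eu' r'].
    by move: Eu'; rewrite Eu => -[eu]; rewrite eu => /r'.
  split=> //; first by move=> y /rE/al.
  exact: collect_frames_weaken cf.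
- case=> lt srt ki al cf; split=> //; exists w => //; split=> //.
  + by move=> y /al[].
  + by move=> y /al[].
- case=> srt ki [u E [le pr al sub cf]].
  case: (child_belongs hok Ec) => lt _ [_ _ _ [u' Eu' r]].
  move: Eu'; rewrite E => -[eu]; rewrite -{}eu in r.
  have lt_i : i < degree u by move: Ec; rewrite (child_inner _ E) => /onth_lt.
  split=> //.
    by move=> y /r[ry iy]; split; [apply: sub | apply: al; rewrite ?iy].
  exists u => //; split=> //.
  + by move=> y /r[ry iy]; split=> //; rewrite iy.
  + by move=> y ry /ltnW; apply: al.
- case=> srt ki [u _ [_ _ _ _ cf]]; split=> //.
  exact: collect_frames_weaken cf.
Qed.

Lemma help_step_ok G h op s h' s' : heap_ok G h -> help_ok G h op s ->
  help_step op h s h' s' ->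
  exists G', [/\ agree (size h) G G', heap_ext h h', heap_ok G' h'
    & help_ok G' h' op s'].
Proof.
move=> hok [t [q [i [Eop d ok]]]] st.
have ex0 : heap_ext h h by apply: heap_ext_refl.
have ag0 : agree (size h) G G by [].
have lt_t := rebuild_lt hok Eop.
have clo := heap_closed hok.
case: st ok => [t' q' i' E _|m h1 m' st|n t' q' i' E _|n c c' st|n kvs h1 a nid
  |a t' q' i' r h1 E dc] /=.
- exists G; split=> //; exists t, q, i; split=> //; split=> //.
  + by move: E; rewrite Eop => -[<- _ _].
  + by move: E; rewrite Eop => -[<- _ _].
  + move=> t2 q2 i2 E2; case: (node_okP hok E) => _ [u Eu] _ _ _.
    by rewrite Eu in E2.
- move=> mo; have [ex ok' mo'] := mark_step_ok hok mo st.
  exists G; split=> //; exists t, q, i; split=> //.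
    exact: rebuild_ext Eop.
  exact: (dead_ext ex ag0 clo lt_t d).
- exists G; split=> //; exists t, q, i; split=> //.
  move: E; rewrite Eop => -[<- _ _]; split=> //.
  by move=> k v j; rewrite onth0n.
- move=> co; exists G; split=> //; exists t, q, i; split=> //.
  exact: collect_step_ok st.
- case=> srt ki _; case: (node_okP hok Eop) => _ _ bt _ bo.
  have [G' [ag ex ok' ba [le nr]]] := heap_ok_ideal hok bt ki nid.
  exists G'; split=> //; exists t, q, i; split.
  + exact: rebuild_ext Eop.
  + exact: (dead_ext ex ag clo lt_t d).
  + by split=> //; apply: leq_trans (node_at_lt Eop) le.
- case=> ba lt nr; move: E; rewrite Eop => -[et eq ei].
  rewrite -eq -ei in dc.
  have ex : heap_ext h h1 by apply: dcss_ext dc (ltnW lt).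
  exists G; split=> //.
    apply: (dcss_ok hok dc (ltnW lt) ba) => t2 q2 j2 E2.
    by case: nr; exists t2, q2, j2.
  exists t, q, i; split=> //; first exact: rebuild_ext Eop.
  exact: (dead_ext ex ag0 clo lt_t d).
Qed.

(** The [Rebuild] node takes over the ghost of its target. *)
Lemma heap_ok_rebuild G h a q i : heap_ok G h ->
  chain G h q [:: (a, i)] -> exists G',
  [/\ agree (size h) G G', heap_ok G' (rcons h (Rebuild a q i))
    & belongs G' (rcons h (Rebuild a q i)) q i (size h)].
Proof.
move=> hok [b ia pa _]; set h' := rcons _ _.
pose G' b := if b == size h then G a else G b.
have ag : agree (size h) G G'.
  by move=> x lt_x; rewrite /G' ifF //; apply/negbTE; rewrite neq_ltn lt_x.
have ex : heap_ext h h' := heap_ext_rcons _.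
have h0 := heap_size_gt0 hok.
have bs : belongs G' h' q i (size h).
  split; [by rewrite size_rcons|by lia|].
  rewrite /G' eqxx; case: b => _ _; exact: (belongs_ghost_ext ex ag).
exists G'; split=> //.
rewrite /h' -cats1; apply: (heap_ok_cat hok ag).
  move=> x; rewrite size_cat addn1 => /andP[le lt]; rewrite /G' ifT; last by
    lia.
  by apply: ltn_trans (heap_closed hok _) _ => //; case: b.
move=> x y le; rewrite cats1 => /node_at_rcons[[-> ->]|[]]; last by lia.
split=> //; first by case: b.
- exact: is_inner_ext ia.
- exact: belongs_ext b.
- by apply: (placed_ext ex ag) pa; case: b.
Qed.

Lemma op_step_ok G h o s h' s' : heap_ok G h -> thread_ok G h o s ->
  op_step R o h s h' s' ->
  exists G', [/\ agree (size h) G G', heap_ext h h', heap_ok G' h'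
    & thread_ok G' h' o s'].
Proof.
move=> hok + st.
have ex0 : heap_ext h h by apply: heap_ext_refl.
have ag0 : agree (size h) G G by [].
have clo := heap_closed hok.
have same s2 : thread_ok G h o s2 -> exists G',
    [/\ agree (size h) G G', heap_ext h h, heap_ok G' h & thread_ok G' h o s2].
  by move=> ok2; exists G.
have [i0 u0 r0 _ _] := hok.
have restart : is_update o -> thread_ok G h o (Descend [::] ist_root).
  by move=> uo; split=> //; apply: r0.
have desc n u i c : node_at h n = Some (Inner u) ->
    i = interpolation_search (op_key o) (keys u) -> child h n i = Some c ->
    rng (G n) (op_key o) -> rng (G c) (op_key o).
  move=> E -> /(child_belongs hok)[_ _ [_ _ _ [u' E' r]]] rn.
  by apply/r; split=> //; move: E'; rewrite E => -[<-].
have repl ns n i c x h1 r : thread_ok G h o (Update ns n i c) ->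
    node_at h c = Some x -> new_replacement h o x = Some (h1, r) ->
    exists G', [/\ agree (size h) G G', heap_ext h h1, heap_ok G' h1,
      belongs G' h1 n i r & c <= r /\ ~ is_rebuild h1 r].
  case=> uo ch en [inn b _ rc] Ex Er.
  have [kvs nid ki] := new_replacement_ideal hok Ex rc Er.
  have [G' [ag ex ok' br [le nr]]] := heap_ok_ideal hok b ki nid.
  exists G'; split=> //; split=> //.
  by case: b => lt_c _ _; apply: ltnW; apply: leq_trans lt_c le.
have tlt := rebuild_lt hok.
case: st => [ns n u i c w En Ei Ec E|ns n u i c t q j En Ei Ec E
  |ns n u i c x En Ei Ec E lx|ns n i c x E nr|ns n i c x h1 r h2 E Er dc
  |ns n i c x h1 r h2 E Er dc|ns n i c x h1 r h2 E Er dc|m j todo ns|ns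
  |q m j todo u E le|q m j todo u E lt|q|a q i h1 dc|a q i r h1 dc nr
  |op k s1 h1 s1' st|op|op|n u c E Ec|n k v E|n E|n t q i E].
- case=> uo ch en inn rn; apply: same; split=> //.
  + apply: chain_rcons => //; first by rewrite -en; apply: child_belongs Ec.
      by exists w.
    exact: child_placed Ec.
  + by rewrite path_end_rcons.
  + by exists w.
  + exact: desc En Ei Ec rn.
- case=> uo ch en inn rn; apply: same; split=> //.
  have [eq ej] := child_rebuild hok Ec E; rewrite eq ej in E.
  exists t, n, i; split=> //; apply: dead_detached.
  exact: rebuild_target_detached Ec E.
- case=> uo ch en inn rn; apply: same; split=> //; split=> //.
  + exact: child_belongs Ec.
  + by exists x.
  + exact: desc En Ei Ec rn.
- by move=> _; apply: same.
- move=> tok; have [G' [ag ex ok' br [le nr]]] := repl _ _ _ _ _ _ _ tok E Er.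
  have ex' := dcss_ext dc le; have ex2 := heap_ext_trans ex ex'.
  exists G'; split=> //.
    by apply: (dcss_ok ok' dc le br) => t q j Er'; case: nr; exists t, q, j.
  by case: tok => uo ch _ _; split=> //; apply: chain_ext ch.
- move=> tok; have [G' [ag ex ok' br [le nr]]] := repl _ _ _ _ _ _ _ tok E Er.
  have ex' := dcss_ext dc le; have ex2 := heap_ext_trans ex ex'.
  exists G'; split=> //.
    by apply: (dcss_ok ok' dc le br) => t q j Er'; case: nr; exists t, q, j.
  apply: (thread_ok_ext ex2 ag clo tlt).
  case: tok => uo ch en [inn b _ rc]; split=> //.
  case: b => _ _ [_ _ _ [u _ r']]; by have [] := (r' _).1 rc.
- move=> tok; have [G' [ag ex ok' br [le nr]]] := repl _ _ _ _ _ _ _ tok E Er.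
  have ex' := dcss_ext dc le; have ex2 := heap_ext_trans ex ex'.
  exists G'; split=> //.
    by apply: (dcss_ok ok' dc le br) => t q j Er'; case: nr; exists t, q, j.
  apply: (thread_ok_ext ex2 ag clo tlt).
  by case: tok => uo _ _ _; apply: restart.
- case=> uo ch; have ex : heap_ext h (fetch_and_add_count h m) by apply:
    ext_incr.
  exists G; split=> //; first exact: heap_ok_incr.
  exact: (thread_ok_ext (s := IncrCounts todo ns) ex ag0 clo tlt).
- by case=> uo ch; apply: same.
- by case=> uo [b ia pa _]; apply: same.
- by case=> uo [b ia pa ch]; apply: same.
- by move=> _; apply: same.
- case=> uo ch; have [G' [ag ok' bs]] := heap_ok_rebuild hok ch.
  have ex : heap_ext h (rcons h (Rebuild a q i)) := heap_ext_rcons _.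
  case: (ch) => b _ _ _; have le : a <= size h by case: (b) => /ltnW.
  have ex' := dcss_ext dc le; have ex2 := heap_ext_trans ex ex'.
  have ok2 : heap_ok G' h1.
    apply: (dcss_ok ok' dc le bs) => t q' j.
    by rewrite node_at_rcons_size => -[_ -> ->].
  exists G'; split=> //; split=> //; exists a, q, i; split=> //.
    by apply: rebuild_ext ex' _ _ _ _ _; apply: node_at_rcons_size.
  have b' := belongs_ext ex2 ag b.
  (* The home of [a] now holds [size h], which is larger than [a]. *)
  apply/dead_detached; split; first by case: b.
  case: b' => _ _ [-> -> _ _]; exists (size h); last by case: b.
  by inversion dc; subst; rewrite (child_set_child _ _ _ H) !eqxx.
- case=> uo ch; have [G' [ag ok' bs]] := heap_ok_rebuild hok ch.
  have ex : heap_ext h (rcons h (Rebuild a q i)) := heap_ext_rcons _.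
  case: (ch) => b _ _ _; have le : a <= size h by case: (b) => /ltnW.
  have ex' := dcss_ext dc le; have ex2 := heap_ext_trans ex ex'.
  exists G'; split=> //; apply: (dcss_ok ok' dc le bs) => t q' j.
  by rewrite node_at_rcons_size => -[_ -> ->].
- case=> uo ho; have [G' [ag ex ok' ho']] := help_step_ok hok ho st.
  by exists G'; split.
- by case=> uo _; apply/same/restart.
- by move=> _; apply: same.
- case=> lo lt; apply: same; split=> //.
  by case: (child_belongs hok Ec).
- by move=> _; apply: same.
- by move=> _; apply: same.
- by case=> lo lt; apply: same; split=> //; apply: tlt E.
Qed.

End Threads.

Context (p : nat).

Local Notation config := (@config disp K V p).
Local Notation memory := (@Defs.mem disp K V p).

(** * Executions *)

Section Executions.

Implicit Types (G : addr -> ghost) (h : heap) (u : inner) (o : operation).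
Implicit Types (c : config) (t : 'I_p).

Definition config_ok G c :=
  heap_ok G (memory c) /\
  forall t o s, threads c t = Running o s -> thread_ok G (memory c) o s.

(** The ghosts of addresses not yet allocated are irrelevant; this permits a single ghost function
    for all times. *)
Lemma config_ok_agree G G' c :
  config_ok G c -> agree (size (memory c)) G G' -> config_ok G' c.
Proof.
case=> hok tok ag; have clo := heap_closed hok; have tlt := rebuild_lt hok.
have ex : heap_ext (memory c) (memory c) by apply: heap_ext_refl.
split; last first.
  by move=> t o s /tok; apply: (thread_ok_ext ex ag clo tlt).
rewrite -[memory c]cats0; apply: (heap_ok_cat hok ag).
  by move=> a; rewrite cats0; lia.
by move=> a x le /node_at_lt; rewrite cats0 ltnNge le.
Qed.

Lemma threads_set_thread c h t x t' :
  threads (set_thread c h t x) t' = if t' == t then x else threads c t'.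
Proof. by []. Qed.

Lemma step_config_ok G c t c' : config_ok G c -> step R c t c' ->
  exists G', [/\ agree (size (memory c)) G G', heap_ext (memory c) (memory c')
    & config_ok G' c'].
Proof.
case=> hok tok; case=> [r o _|o s h' s' Et st|o r _].
- exists G; split=> //; first exact: heap_ext_refl.
  split=> // t' o' s' /=; case: eqP => _; last exact: tok.
  have [i0 _ r0 _ _] := hok.
  case=> <- <-; case: o => [k v|k|k] /=; split=> //.
  exact: heap_size_gt0 hok.
- have [G' [ag ex ok' tok']] := op_step_ok hok (tok _ _ _ Et) st.
  exists G'; split=> //; split=> // t' o' s2 /=; case: eqP => _.
    by case=> <- <-.
  move/tok; exact: (thread_ok_ext ex ag (heap_closed hok) (rebuild_lt hok)).
- exists G; split=> //; first exact: heap_ext_refl.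
  by split=> // t' o' s' /=; case: eqP => _; last exact: tok.
Qed.

Lemma init_config_ok : exists G, config_ok G (init_config p).
Proof.
exists (fun a => if a == 0 then Ghost 0 0 0 (fun _ => True)
                 else Ghost 0 0 1 (fun _ => True)).
split=> //; split=> //.
- by eexists.
- by move=> a _; case: eqP.
- case=> [|[|a]] x; last by rewrite /node_at /= onth0n.
    case=> <-; split=> //= -[|i] b /=; last by rewrite onth0n.
    case=> <-; split; last by move=> t q j.
    by split=> //; split=> //=; eexists.
  by case=> <-.
Qed.

(** Each step extends the ghost function to the new nodes only. Dependent choice gives a sequence of
    functions that agree on the nodes allocated so far, and these are glued together. *)
Lemma execution_config_ok (c : nat -> config) sched : execution R c sched ->
  exists G, (forall m, config_ok G (c m)) /\
    forall m, heap_ext (memory (c m)) (memory (c m.+1)).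
Proof.
case=> c0 ex; pose T m := {G | config_ok G (c m)}.
have first : T 0 by apply: cid; rewrite c0; apply: init_config_ok.
have nx m (x : T m) : {y : T m.+1 | agree (size (memory (c m))) (sval x) (sval
  y) /\
    heap_ext (memory (c m)) (memory (c m.+1))}.
  apply: cid; have := ex m; case: (sched m) => [t|E].
    case: x => G ok /= /(step_config_ok ok)[G' [ag he ok']].
    by exists (exist _ G' ok').
  case: x => G ok; have ok' : config_ok G (c m.+1) by rewrite E.
  exists (exist _ G ok'); split=> //=; rewrite E; exact: heap_ext_refl.
pose S := fix S m : T m := if m is m'.+1 then sval (nx m' (S m')) else first.
have he m : heap_ext (memory (c m)) (memory (c m.+1)).
  by case: (nx m (S m)) => y [].
have szle m n : m <= n -> size (memory (c m)) <= size (memory (c n)).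
  move=> /subnK<-; elim: (n - m) => //= d IH.
  by apply: leq_trans IH _; apply: heap_ext_size.
have ag m n : m <= n -> agree (size (memory (c m))) (sval (S m)) (sval (S n)).
  move=> /subnK<-; elim: (n - m) => //= d IH.
  apply: agree_trans (szle m (d + m) _) IH _; first exact: leq_addl.
  by case: (nx (d + m) (S (d + m))) => y [].
(* The ghost of [a] is read off at any time at which [a] is allocated; by [ag] the choice does not
   matter. *)
pose G a := if pselect (exists m, a < size (memory (c m))) is left e
            then sval (S (sval (cid e))) a else sval (S 0) a.
exists G; split=> // m; apply: (config_ok_agree (svalP (S m))) => a lt_a.
rewrite /G; case: pselect => [e|[]]; last by exists m.
case: cid => n lt_n /=; case: (leqP m n) => [le|/ltnW le]; first by rewrite (ag
  m n).
by rewrite (ag n m).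
Qed.

(** * Absence of blocked operations *)

Lemma dcss_total h n i a w y st : exists r h', dcss h n i a w y st r h'.
Proof.
case: (pselect (child h n i = Some a)) => [Ec|]; last first.
  by move=> Ec; do 2 eexists; apply: DcssFailedMain.
case: (pselect (status_at h y = Some st)) => Es.
  by do 2 eexists; apply: DcssSuccess.
by do 2 eexists; apply: DcssFailedAux.
Qed.

Lemma child_exists G h a u i : heap_ok G h -> node_at h a = Some (Inner u) ->
  i < degree u -> exists b, child h a i = Some b /\
    exists x, node_at h b = Some x.
Proof.
move=> hok E /lt_onth[b Eb]; have Ec : child h a i = Some b.
  by rewrite (child_inner _ E).
by exists b; split=> //; apply: lt_node_at; apply: belongs_lt (child_belongs
  hok Ec).
Qed.

Lemma search_child_exists G h n u (k : K) : heap_ok G h ->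
  node_at h n = Some (Inner u) ->
  exists b, child h n (interpolation_search k (keys u)) = Some b /\
    exists x, node_at h b = Some x.
Proof.
move=> hok E; apply: (child_exists hok E).
case: (node_okP hok E) => es _ _; rewrite /degree es ltnS; exact: interp_le.
Qed.

Lemma mark_progress G h m : heap_ok G h -> mark_ok G h m ->
  (exists n, m = MarkReturn n [::]) \/ exists h' m', mark_step h m h' m'.
Proof.
move=> hok; case: m => [a stk|a i n stk|b a i n stk|n [|[[a i] n'] stk]] /=.
- case=> /lt_node_at[x E] _ _ _; right; case: x E => [|k v|u|t q i] E.
  + by do 2 eexists; apply: MarkCallEmpty.
  + by do 2 eexists; apply: MarkCallSingle E.
  + by do 2 eexists; apply: MarkCallInner E.
  + by do 2 eexists; apply: MarkCallRebuild E.
- case=> -[u E [le _]] _; right; move: le; rewrite leq_eqVlt => /orP[/eqP->|lt].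
    by do 2 eexists; apply: MarkLoopExit.
  have [b [Eb [x Ex]]] := child_exists hok E lt.
  case: x Ex => [|k v|w|t q j] Ex.
  + by do 2 eexists; apply: MarkLoopEmpty Eb Ex.
  + by do 2 eexists; apply: MarkLoopSingle Eb Ex.
  + by do 2 eexists; apply: MarkLoopInner Eb Ex.
  + by do 2 eexists; apply: MarkLoopRebuild Eb Ex.
- case=> -[u E] _ _ _; right; have Es : status_at h b = Some (stat u).
    by rewrite /status_at E.
  case: (stat u) Es => [[m []] s] Es.
    by do 2 eexists; apply: MarkStatusFinished Es.
  by do 2 eexists; apply: MarkStatusUnfinished Es.
- by left; exists n.
- by right; do 2 eexists; apply: MarkReturnFrame.
Qed.

Lemma collect_progress G h (t : addr) (s : collect_pc) : heap_ok G h ->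
  collect_ok G h t s ->
  (exists kvs, s = Collect [::] kvs) \/ exists s', collect_step h s s'.
Proof.
move=> hok; case: s => [a stk kvs|[|[a i] stk] kvs] /=.
- case=> /lt_node_at[x E] _ _ _ _; right; case: x E => [|k v|u|q i j] E.
  + by eexists; apply: VisitEmpty.
  + by eexists; apply: VisitSingle E.
  + by eexists; apply: VisitInner E.
  + by eexists; apply: VisitRebuild E.
- by left; exists kvs.
- case=> _ _ [u E [le _ _ _ _]]; right.
  move: le; rewrite leq_eqVlt => /orP[/eqP->|lt].
    by eexists; apply: CollectExit.
  have [b [Eb _]] := child_exists hok E lt.
  by eexists; apply: CollectChild Eb.
Qed.

Lemma help_progress G h op (s : help_pc) : heap_ok G h -> help_ok G h op s ->
  s = HelpDone \/ exists h' s', help_step op h s h' s'.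
Proof.
move=> hok [t [q [i [E d]]]]; case: s => [_|m|n a|a|_].
- by right; do 2 eexists; apply: HelpStartStep E.
- case/(mark_progress hok) => [[n ->]|[h' [m' st]]]; right; do 2 eexists.
    exact: HelpMarkExit E.
  exact: HelpMarkStep st.
- move=> co; right; have [[kvs Ea]|[a' st]] := collect_progress hok co.
    (* The invariant of the traversal supplies the strict order that an ideal tree needs. *)
    move: co; rewrite Ea => -[srt _ _]; have [h' [b nid]] := new_ideal_exists h
      srt.
    by do 2 eexists; apply: HelpCreateExit nid.
  by do 2 eexists; apply: HelpCreateStep st.
- move=> _; right; have [r [h' dc]] := dcss_total h q i op a q clean.
  by do 2 eexists; apply: InstallStep E dc.
- by left.
Qed.

Lemma op_progress G h o (s : pc) : heap_ok G h -> thread_ok G h o s ->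
  (exists r, s = Return r) \/ exists h' s', op_step R o h s h' s'.
Proof.
move=> hok; case: s => [ns n|ns n i a|[|[m j] todo] ns|q [|[m j] todo]|a q i|op
  k s|a|r].
- case=> _ _ _ [u E] _; right.
  have [b [Eb [x Ex]]] := search_child_exists (op_key o) hok E.
  case: x Ex => [|k v|w|t q j] Ex; do 2 eexists.
  + exact: (DescendLeaf R _ E erefl Eb Ex).
  + exact: (DescendLeaf R _ E erefl Eb Ex).
  + exact: (DescendInner R _ E erefl Eb Ex).
  + exact: (DescendRebuild R _ E erefl Eb Ex).
- case=> _ _ _ [_ _ [x Ex _] _]; right.
  case Er: (new_replacement h o x) => [[h1 r]|]; last first.
    by do 2 eexists; apply: UpdateNothing Ex Er.
  have [[] [h2 dc]] := dcss_total h1 n i a r n clean; do 2 eexists.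
  + exact: UpdateSuccess Ex Er dc.
  + exact: UpdateFailedMain Ex Er dc.
  + exact: UpdateFailedAux Ex Er dc.
- by right; do 2 eexists; apply: IncrCountsExit.
- by right; do 2 eexists; apply: IncrCountsStep.
- by right; do 2 eexists; apply: CheckCountsExit.
- case=> _ [_ [u E] _ _]; right.
  case: (lerP (R * (init_size u)%:R)%R (cnt u)%:R%R) => le; do 2 eexists.
    exact: CheckCountsAbove E le.
  exact: CheckCountsBelow E le.
- move=> _; right.
  have [r [h' dc]] := dcss_total (rcons h (Rebuild a q i)) q i a (size h) q
    clean.
  case: r dc => dc; do 2 eexists.
  + exact: StartRebuildSuccess dc.
  + exact: StartRebuildFailed dc _.
  + exact: StartRebuildFailed dc _.
- case=> uo ho; right; have [->|[h' [s' st]]] := help_progress hok ho.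
    by case: k; do 2 eexists; [apply: HelpRestart | apply: HelpFinish].
  by do 2 eexists; apply: HelpStep st.
- case=> _ /lt_node_at[x E]; right; case: x E => [|k v|u|q i j] E.
  + by do 2 eexists; apply: SearchEmpty.
  + by do 2 eexists; apply: SearchSingle E.
  + have [b [Eb _]] := search_child_exists (op_key o) hok E.
    by do 2 eexists; apply: SearchInner E Eb.
  + by do 2 eexists; apply: SearchRebuild E.
- by left; exists r.
Qed.

Lemma never_stuck_any (P : pred operation) : never_stuck R p P.
Proof.
move=> c sched /execution_config_ok[G [ok _]] t n [o [s [Et _]]].
have [hok tok] := ok n.
have [[r Es]|[h' [s' st]]] := op_progress hok (tok _ _ _ Et).
  by eexists; apply: StepReturn; rewrite Et Es.
by eexists; apply: StepRun Et st.
Qed.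

End Executions.

(** * Effects of a step on the slots *)

Section StepEffects.

Implicit Types (G : addr -> ghost) (h : heap) (o : operation).

Lemma child_cat h l q i : q < size h -> child (h ++ l) q i = child h q i.
Proof. by move=> lt_q; rewrite /child /node_at onth_cat lt_q. Qed.

Lemma child_rcons h x q i : q < size h -> child (rcons h x) q i = child h q i.
Proof. by rewrite -cats1; apply: child_cat. Qed.

Lemma status_at_cat h l q : q < size h -> status_at (h ++ l) q = status_at h q.
Proof. by move=> lt_q; rewrite /status_at /node_at onth_cat lt_q. Qed.

Lemma child_lt h q i a : child h q i = Some a -> q < size h.
Proof. by case/child_inv => u /node_at_lt. Qed.

Lemma child_update h n f q i :
  (forall u, node_at h n = Some (Inner u) -> children (f u) = children u) ->
  child (update h n f) q i = child h q i.
Proof.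
move=> fE; case: (pselect (is_inner h n)) => [[u E]|/update_id -> //].
rewrite /child (node_at_update _ _ E); case: eqP => // ->.
by rewrite E fE.
Qed.

Lemma child_cas h n old new q i :
  child (cas_status h n old new) q i = child h q i.
Proof. by apply: child_update => u _; case: eqP. Qed.

Lemma child_incr h n q i : child (fetch_and_add_count h n) q i = child h q i.
Proof. exact: child_update. Qed.

Lemma child_mark_step h m h' m' q i :
  mark_step h m h' m' -> child h' q i = child h q i.
Proof. by case=> // *; rewrite child_cas. Qed.

Lemma new_ideal_cat h (kvs : seq (K * V)) h' a : 0 < size h ->
  new_ideal h kvs h' a ->
  (exists l, h' = h ++ l) /\
  forall q i b, size h <= q -> child h' q i = Some b -> ~ is_rebuild h' b.
Proof.
move=> h0 nid; pose g : ghost := Ghost 0 0 0 (fun _ => True).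
have [//|G [_ _ _ [pre _] [_ fr]]] := new_ideal_spec nid h0 (fun _ => g) (g :=
  g).
split=> // q i b le_q /child_inv[u E Eb].
by have [_ /(_ _ _ Eb)[]] := fr _ _ le_q E.
Qed.

Lemma new_replacement_cat G h o a x h1 r : heap_ok G h ->
  node_at h a = Some x -> rng (G a) (op_key o) ->
  new_replacement h o x = Some (h1, r) ->
  (exists l, h1 = h ++ l) /\
  forall q i b, size h <= q -> child h1 q i = Some b -> ~ is_rebuild h1 b.
Proof.
move=> hok Ex rk Er; have [kvs nid _] := new_replacement_ideal hok Ex rk Er.
exact: new_ideal_cat (heap_size_gt0 hok) nid.
Qed.

(** Updates and starts of rebuildings are recognised by control states. An installation is recorded
    by its effect on the slot, a [Rebuild] giving way to something else: when the other two kinds of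
    change have ceased, this happens at most once in a slot. *)
Variant slot_effect h (s : pc) h' (s' : pc) (q : addr) (i : nat) (a : addr) :
  Prop :=
| SlotSame of child h' q i = Some a
| SlotUpdate ns of s = Update ns q i a & s' = IncrCounts ns ns
| SlotStart op of s = StartRebuild a q i & s' = Help op Finish HelpStart
| SlotInstall b of is_rebuild h a & child h' q i = Some b & ~ is_rebuild h' b.

Lemma dcss_child h n i a w y st r h' q j b : dcss h n i a w y st r h' ->
  child h q j = Some b ->
  child h' q j = Some b \/
  [/\ r = Success, q = n, j = i, a = b & child h' q j = Some w].
Proof.
case=> [Ec _|_|_]; [|by left|by left].
rewrite (child_set_child _ _ _ Ec); case: eqP => [-> |]; last by left.
case: eqP => [->|]; last by left.
by rewrite Ec => -[<-]; right; split.
Qed.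

Lemma dcss_cases h n i a w y st r h' :
  dcss h n i a w y st r h' ->
  [\/ h' = update h n (set_child i w), child h n i <> Some a
    | status_at h y <> Some st].
Proof. by case; [constructor 1|constructor 2|constructor 3]. Qed.

Lemma op_step_slot G h o s h' s' : heap_ok G h -> thread_ok G h o s ->
  op_step R o h s h' s' -> forall q i a, child h q i = Some a ->
  slot_effect h s h' s' q i a.
Proof.
move=> hok + st.
case: st => [ns n u i c w En Ei Ec E|ns n u i c t q j En Ei Ec E
  |ns n u i c x En Ei Ec E lx|ns n i c x E nr|ns n i c x h1 r h2 E Er dc
  |ns n i c x h1 r h2 E Er dc|ns n i c x h1 r h2 E Er dc|m j todo ns|ns
  |q m j todo u E le|q m j todo u E lt|q|a q i h1 dc|a q i r h1 dc nr
  |op k s1 h1 s1' st|op|op|n u c E Ec|n k v E|n E|n t q i E];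
  move=> tok q' i' b Eb; try by apply: SlotSame.
- case: tok => _ _ _ [_ _ _ rk].
  have [[l h1E] _] := new_replacement_cat hok E rk Er.
  have Eb1 : child h1 q' i' = Some b by rewrite h1E child_cat ?(child_lt Eb).
  have [|[_ -> -> <- _]] := dcss_child dc Eb1; first exact: SlotSame.
  exact: SlotUpdate.
- case: tok => _ _ _ [_ _ _ rk].
  have [[l h1E] _] := new_replacement_cat hok E rk Er.
  have Eb1 : child h1 q' i' = Some b by rewrite h1E child_cat ?(child_lt Eb).
  by have [|[]] := dcss_child dc Eb1; first exact: SlotSame.
- case: tok => _ _ _ [_ _ _ rk].
  have [[l h1E] _] := new_replacement_cat hok E rk Er.
  have Eb1 : child h1 q' i' = Some b by rewrite h1E child_cat ?(child_lt Eb).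
  by have [|[]] := dcss_child dc Eb1; first exact: SlotSame.
- by apply: SlotSame; rewrite child_incr.
- have Eb1 : child (rcons h (Rebuild a q i)) q' i' = Some b.
    by rewrite child_rcons ?(child_lt Eb).
  have [|[_ -> -> <- _]] := dcss_child dc Eb1; first exact: SlotSame.
  exact: SlotStart.
- have Eb1 : child (rcons h (Rebuild a q i)) q' i' = Some b.
    by rewrite child_rcons ?(child_lt Eb).
  by have [|[]] := dcss_child dc Eb1; first exact: SlotSame.
- case: tok => _ [t [q [i [Eop _]]]].
  case: st => [t1 q1 i1 E1|m1 h2 m1' st|n t1 q1 i1 E1|n c c' st|n kvs h2 a nid
    |a t1 q1 i1 r h2 E1 dc] tok; try by apply: SlotSame.
  + by apply: SlotSame; rewrite (child_mark_step _ _ st).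
  + have [[l ->] _] := new_ideal_cat (heap_size_gt0 hok) nid.
    by apply: SlotSame; rewrite child_cat ?(child_lt Eb).
  + have [|[_ eq ei eb Ew]] := dcss_child dc Eb; first exact: SlotSame.
    case: tok => ba lt nr; have ex := dcss_ext dc (ltnW lt).
    rewrite -{}eb; apply: SlotInstall Ew _; first by exists t, q, i.
    case=> t2 [q2 [i2 /(rebuild_ext_inv ex (belongs_lt ba)) E2]].
    by apply: nr; exists t2, q2, i2.
Qed.

(** A DCSS writes into a node that existed before the step, so the slots of the nodes just allocated
    are still those of a fresh tree. *)
Lemma op_step_new_slot G h o s h' s' : heap_ok G h -> thread_ok G h o s ->
  op_step R o h s h' s' -> forall q i a, size h <= q ->
  child h' q i = Some a -> ~ is_rebuild h' a.
Proof.
move=> hok + st.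
have old h2 q i a : (forall q i, child h2 q i = child h q i) ->
    size h <= q -> child h2 q i = Some a -> ~ is_rebuild h2 a.
  by move=> E le_q; rewrite E => /child_lt; rewrite ltnNge le_q.
have new h1 n i a w y s0 r h2 q j b : dcss h1 n i a w y s0 r h2 -> n < size h ->
    heap_ext h1 h2 ->
    (forall q i b, size h <= q -> child h1 q i = Some b -> b < size h1 /\ ~
      is_rebuild h1 b) ->
    size h <= q -> child h2 q j = Some b -> ~ is_rebuild h2 b.
  move=> dc lt_n ex nr le_q Eb.
  have Eb1 : child h1 q j = Some b.
    case: dc Eb => // Ec _; rewrite (child_set_child _ _ _ Ec).
    by case: eqP le_q => [->|//]; rewrite leqNgt lt_n.
  have [lt_b nrb] := nr _ _ _ le_q Eb1.
  by case=> t [q2 [i2 /(rebuild_ext_inv ex lt_b) E]]; apply: nrb; exists t, q2,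
    i2.
have repl ns n i c x h1 r res h2 : thread_ok G h o (Update ns n i c) ->
    node_at h c = Some x -> new_replacement h o x = Some (h1, r) ->
    dcss h1 n i c r n clean res h2 -> 
    forall q j b, size h <= q -> child h2 q j = Some b -> ~ is_rebuild h2 b.
  case=> _ _ _ [inn b0 _ rk] E Er dc q j b.
  have [kvs nid ki] := new_replacement_ideal hok E rk Er.
  have [G' [ag ex ok' br [le nr]]] := heap_ok_ideal hok b0 ki nid.
  have [_ nr'] := new_replacement_cat hok E rk Er.
  apply: (new _ _ _ _ _ _ _ _ _ _ _ _ dc (is_inner_lt inn)).
    apply: dcss_ext dc (leq_trans _ le); by apply: ltnW; case: b0.
  move=> q1 i1 b1 le1 E1; split; last exact: nr' E1.
  exact: belongs_lt (child_belongs ok' E1).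
case: st => [ns n u i c w En Ei Ec E|ns n u i c t q j En Ei Ec E
  |ns n u i c x En Ei Ec E lx|ns n i c x E nr|ns n i c x h1 r h2 E Er dc
  |ns n i c x h1 r h2 E Er dc|ns n i c x h1 r h2 E Er dc|m j todo ns|ns
  |q m j todo u E le|q m j todo u E lt|q|a q i h1 dc|a q i r h1 dc nr
  |op k s1 h1 s1' st|op|op|n u c E Ec|n k v E|n E|n t q i E];
  move=> tok q' i' b; try by apply: old.
- exact: repl tok E Er dc _ _ _.
- exact: repl tok E Er dc _ _ _.
- exact: repl tok E Er dc _ _ _.
- by apply: old => q i; rewrite child_incr.
- case: tok => _ [b0 _ _ _].
  apply: (new _ _ _ _ _ _ _ _ _ _ _ _ dc).
  + by case: b0 => _ _ [_ _ _ [u /node_at_lt]].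
  + by apply: dcss_ext dc _; apply: ltnW; case: b0.
  + move=> q1 i1 b1 le1 /child_inv[u /node_at_rcons[[_ //]|[lt1 _]]].
    by rewrite leqNgt lt1 in le1.
- case: tok => _ [b0 _ _ _].
  apply: (new _ _ _ _ _ _ _ _ _ _ _ _ dc).
  + by case: b0 => _ _ [_ _ _ [u /node_at_lt]].
  + by apply: dcss_ext dc _; apply: ltnW; case: b0.
  + move=> q1 i1 b1 le1 /child_inv[u /node_at_rcons[[_ //]|[lt1 _]]].
    by rewrite leqNgt lt1 in le1.
- case: tok => _ [t [q [i [Eop _]]]].
  case: st => [t1 q1 i1 E1|m1 h2 m1' st|n t1 q1 i1 E1|n c c' st|n kvs h2 a nid
    |a t1 q1 i1 r h2 E1 dc] tok; try by apply: old.
  + by apply: old => q2 i2; rewrite (child_mark_step _ _ st).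
  + have [_ nr] := new_ideal_cat (heap_size_gt0 hok) nid; exact: nr.
  + move: E1; rewrite Eop => -[_ eq ei]; rewrite -eq -ei in dc.
    case: tok => ba lt nr; apply: (new _ _ _ _ _ _ _ _ _ _ _ _ dc).
    * by case: ba => _ _ [_ _ _ [u /node_at_lt]].
    * exact: dcss_ext dc (ltnW lt).
    * by move=> q2 i2 b2 le2 /child_lt; rewrite ltnNge le2.
Qed.

(** On success the slot holds the [Rebuild] node, which is younger than [a]. If the main address
    does not match, the home of [a] holds something else, hence something larger, since [a] was once
    stored there. If the auxiliary one does not, the status of the parent is not clean, so the
    parent is dead, and [a] with it. *)
Lemma start_rebuild_dead G h o a q i h' s' :
  thread_ok G h o (StartRebuild a q i) -> heap_ok G h' -> heap_ext h h' ->
  op_step R o h (StartRebuild a q i) h' s' -> dead G h' a.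
Proof.
case=> _ [b _ pl _] hok' ex st; have ag : agree (size h) G G by [].
have b' := belongs_ext ex ag b; have pl' := placed_ext ex ag (belongs_lt b) pl.
have nin : child h' q i <> Some a -> dead G h' a.
  by move=> ne; apply/dead_detached/(placed_detached b' pl').
inversion st as [| | | | | | | | | | | |a0 q0 i0 h0 dc|a0 q0 i0 r h0 dc nr| | |
  | | | |];
  subst.
  apply: nin; inversion dc; subst; rewrite (child_set_child _ _ _ H) !eqxx =>
    -[e].
  by case: b; rewrite -e ltnn.
inversion dc; subst; first by case: nr.
  exact: nin.
apply: (dead_belongs b'); case: b' => _ _ [_ _ _ [u Eu _]].
have [_ _] := node_okP hok' Eu; apply=> st0.
by move: H; rewrite /status_at Eu st0.
Qed.

End StepEffects.

(** * Slots that are eventually constant *)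

Section Progress.

Variables (c : nat -> config) (sched : nat -> option 'I_p) (G : addr -> ghost).
Hypotheses (exec : execution R c sched) (ok : forall m, config_ok G (c m)).
Hypothesis ext1 : forall m, heap_ext (memory (c m)) (memory (c m.+1)).

Notation H m := (memory (c m)).
Implicit Types (t : 'I_p) (o : operation).

Lemma heap_okm m : heap_ok G (H m).
Proof. by case: (ok m). Qed.

Lemma thread_okm m t o s : threads (c m) t = Running o s -> thread_ok G (H m) o
  s.
Proof. by case: (ok m) => _; apply. Qed.

Lemma ext_le m n : m <= n -> heap_ext (H m) (H n).
Proof.
move/subnK<-; elim: (n - m) => [|d IH]; first exact: heap_ext_refl.
by rewrite addSn; apply: (heap_ext_trans IH); apply: ext1.
Qed.

Lemma size_le m n : m <= n -> size (H m) <= size (H n).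
Proof. by move/ext_le/heap_ext_size. Qed.

Lemma dead_le m n a : m <= n -> a < size (H m) -> dead G (H m) a -> dead G (H
  n) a.
Proof.
move=> le lt; apply: (dead_ext (ext_le le) _ _ lt) => //.
exact: heap_closed (heap_okm m).
Qed.

Variant thread_trans (h : heap) (x : thread) (h' : heap) : thread -> Prop :=
| TransInvoke r o of x = Idle r : thread_trans h x h' (Running o (start o))
| TransRun o s s' of x = Running o s & op_step R o h s h' s' :
    thread_trans h x h' (Running o s')
| TransReturn o r of x = Running o (Return r) : thread_trans h x h' (Idle r).

Lemma thread_step m t :
  threads (c m.+1) t = threads (c m) t \/
  sched m = Some t /\
  thread_trans (H m) (threads (c m) t) (H m.+1) (threads (c m.+1) t).
Proof.
have := exec.2 m; case Es: (sched m) => [t'|]; last by move=> E; left; rewrite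
  E.
case: (eqVneq t t') => [->|ne] st; last first.
  by left; case: st => *; rewrite threads_set_thread (negPf ne).
right; split=> //.
case: st => [r o E|o s h' s' E st|o r E]; rewrite threads_set_thread eqxx.
- exact: TransInvoke E.
- exact: TransRun E st.
- exact: TransReturn E.
Qed.

Lemma sched_trans m t : sched m = Some t ->
  thread_trans (H m) (threads (c m) t) (H m.+1) (threads (c m.+1) t).
Proof.
move=> Es; have := exec.2 m; rewrite Es.
case=> [r o E|o s h' s' E st|o r E]; rewrite threads_set_thread eqxx.
- exact: TransInvoke E.
- exact: TransRun E st.
- exact: TransReturn E.
Qed.

Lemma heap_step m :
  H m.+1 = H m \/ exists t o s s', [/\ threads (c m) t = Running o s,
    threads (c m.+1) t = Running o s' & op_step R o (H m) s (H m.+1) s'].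
Proof.
have := exec.2 m; case: (sched m) => [t|E]; last by left; rewrite E.
case=> [r o E|o s h' s' E st|o r E]; try by left.
by right; exists t, o, s, s'; rewrite threads_set_thread eqxx.
Qed.

Lemma thread_inv (Q : thread -> Prop) m t :
  (forall x', Q (threads (c m) t) ->
    thread_trans (H m) (threads (c m) t) (H m.+1) x' ->
    threads (c m.+1) t = x' -> Q x') ->
  Q (threads (c m) t) -> Q (threads (c m.+1) t).
Proof.
move=> QQ q; case: (thread_step m t) => [->//|[_ tr]].
exact: QQ q tr erefl.
Qed.

Lemma thread_idle t m n : m <= n ->
  (forall i, m <= i < n -> sched i <> Some t) -> threads (c n) t = threads (c
    m) t.
Proof.
move/subnK<-; elim: (n - m) => [//|d IH] no; rewrite addSn.
case: (thread_step (d + m) t) => [->|[Es]].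
  by apply: IH => i lt; apply: no; lia.
by case: (no (d + m)) => //; lia.
Qed.

Definition taken_forever t := forall n, exists m, n <= m /\ sched m = Some t.

Lemma next_step t n : taken_forever t ->
  exists m, [/\ n <= m, sched m = Some t & threads (c m) t = threads (c n) t].
Proof.
move=> inf; have ex : exists m, (n <= m) && (sched m == Some t).
  by have [m [le Es]] := inf n; exists m; rewrite le Es eqxx.
case: (ex_minnP ex) => m /andP[le /eqP Es] min; exists m; split=> //.
apply: thread_idle => // i /andP[le_i lt_i] Ei.
by have := min i; rewrite le_i Ei eqxx leqNgt lt_i => /(_ isT).
Qed.

(** The state of a thread changes only by its own steps, so the descent concerns these alone and
    waits for the next one whenever other threads run. *)
Lemma measure_false t n (Q : thread -> Prop) (mu : thread -> nat) :
  taken_forever t -> Q (threads (c n) t) ->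
  (forall m, n <= m -> sched m = Some t -> Q (threads (c m) t) ->
    Q (threads (c m.+1) t) /\ mu (threads (c m.+1) t) < mu (threads (c m) t)) ->
  False.
Proof.
move=> inf Qn dec; suff main k i : n <= i -> Q (threads (c i) t) ->
    mu (threads (c i) t) <= k -> False by exact: (main _ n).
elim: k i => [|k IH] i le_i Qi mu_i; have [m [le Es Et]] := next_step i inf;
  have le_m := leq_trans le_i le; rewrite -Et in Qi mu_i;
  have [Qm lt] := dec m le_m Es Qi; first by lia.
by apply: (IH m.+1) => //; lia.
Qed.

Section Static.

(** For lookups [S] will consist of the nodes below a given node, for updates of all the nodes. *)
Variable S : addr -> Prop.
Hypothesis S_up : forall a, S (up (G a)) -> S a.

(* The success of a DCSS shows in the control state of the thread before and
   after the step. *)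
Definition update_in m t := exists o ns n i a,
  [/\ threads (c m) t = Running o (Update ns n i a),
      threads (c m.+1) t = Running o (IncrCounts ns ns) & S n].

Definition rebuild_in m t := exists o a q i op,
  [/\ threads (c m) t = Running o (StartRebuild a q i),
      threads (c m.+1) t = Running o (Help op Finish HelpStart) & S q].

Lemma chain_end_in (h : heap) q ns : chain G h q ns -> S q -> S (path_end q ns).
Proof.
elim: ns q => [//|[m j] r IH] q /= [[_ _ [eu _ _ _]] _ _ ch] Sq.
by apply: IH ch _; apply: S_up; rewrite eu.
Qed.

(** The test is on the end of the path: a rebuilding whose parent is in [S] follows an update at the
    end of the path, which is then in [S] as well. *)
Definition may_rebuild (x : thread) : Prop :=
  match x with
  | Running _ (IncrCounts _ ns) => S (path_end 0 ns)
  | Running _ (CheckCounts q todo) => S (path_end q todo)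
  | Running _ (StartRebuild _ q _) => S q
  | _ => False
  end.

(** Only an update in [S] leads into [may_rebuild], and starting a rebuilding leaves it. Without
    such updates, each thread starts at most one more rebuilding in [S]. *)
Lemma no_rebuild_in n : (forall m t, n <= m -> ~ update_in m t) ->
  exists2 N, n <= N & forall t m, N <= m -> ~ rebuild_in m t.
Proof.
move=> noU; apply: eventually_fin => t.
apply: (@eventually_not _ (fun m => ~ may_rebuild (threads (c m) t))).
- by move=> m _ [o [a [q [i [op [_ -> _]]]]]].
- move=> m le; apply: (@thread_inv (fun x => ~ may_rebuild x)) => x' nm tr.
  case: tr nm (@thread_okm m t) => [r o _|o s s' E st|o r _]; last 1 first.
  + by move=> _ _ _ [].
  + by case: o => [k v|k|k] _ _ _ [].
  rewrite E => nm /(_ _ _ erefl) tok Et.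
  have noUm := noU m t le; rewrite /update_in E Et in noUm.
  case: st tok nm noUm {E Et} => //; try by intros; intro no_state; case:
    no_state.
  + move=> ns k i a x h1 r h2 _ _ _ [_ _ -> _] _ noUm Sk.
    by apply: noUm; do 5 eexists.
  + move=> q m' j todo u _ _ [_ ch] nm _ Sq; apply: nm.
    exact: chain_end_in ch Sq.
- by move=> m le nm [o [a [q [i [op [E _ Sq]]]]]]; apply: nm; rewrite E.
Qed.

Lemma rebuild_back m n a : m <= n -> a < size (H m) ->
  is_rebuild (H n) a -> is_rebuild (H m) a.
Proof.
by move=> le lt [t [q [i /(rebuild_ext_inv (ext_le le) lt) E]]]; exists t, q, i.
Qed.

Section NoChange.

Variable n : nat.
Hypothesis noU : forall m t, n <= m -> ~ update_in m t.
Hypothesis noR : forall m t, n <= m -> ~ rebuild_in m t.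

Lemma slot_step m q i a : n <= m -> S q -> child (H m) q i = Some a ->
  child (H m.+1) q i = Some a \/
  is_rebuild (H m) a /\
  exists2 b, child (H m.+1) q i = Some b & ~ is_rebuild (H m.+1) b.
Proof.
move=> le Sq Ea; case: (heap_step m) => [->|[t [o [s [s' [E E' st]]]]]]; first
  by left.
have tok := thread_okm E.
case: (op_step_slot (heap_okm m) tok st Ea) => [|ns es es'|op es es'|b ra Eb
  nb].
- by left.
- case: (noU (t := t) le); exists o, ns, q, i, a.
  by rewrite E E' es es'.
- case: (noR (t := t) le); exists o, a, q, i, op.
  by rewrite E E' es es'.
- by right; split=> //; exists b.
Qed.

Lemma slot_fixed m k q i a : n <= m -> m <= k -> S q ->
  child (H m) q i = Some a -> ~ is_rebuild (H m) a -> child (H k) q i = Some a.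
Proof.
move=> le_n le_m Sq Ea nr; have lt_a := belongs_lt (child_belongs (heap_okm m)
  Ea).
move: le_m => /subnK<-; elim: (k - m) => [//|d IH].
have [|//|[ra _]] := slot_step _ Sq IH; first by lia.
by case: nr; apply: rebuild_back ra => //; apply: leq_addl.
Qed.

Lemma new_slot_not_rebuild m q i a : n <= m -> S q -> size (H n) <= q ->
  child (H m) q i = Some a -> ~ is_rebuild (H m) a.
Proof.
move/subnK<-; elim: (m - n) a => [|d IH] a Sq le_q.
  by move/child_lt; rewrite ltnNge le_q.
rewrite addSn => Ea; have [lt_q|ge_q] := ltnP q (size (H (d + n))).
  have [b Eb _] := child_ext_inv (@ext1 _) lt_q Ea.
  have nb := IH b Sq le_q Eb; have [|Eb'|[//]] := slot_step _ Sq Eb; first by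
    lia.
  move: Ea; rewrite Eb' => -[<-] rb; apply: nb; apply: rebuild_back rb; first
    exact: leqW.
  exact: belongs_lt (child_belongs (heap_okm _) Eb).
case: (heap_step (d + n)) => [E|[t [o [s [s' [E E' st]]]]]].
  by move: Ea; rewrite E => /child_lt; rewrite ltnNge ge_q.
exact: (op_step_new_slot (heap_okm _) (thread_okm E) st ge_q Ea).
Qed.

Lemma child_none m k q i : m <= k -> q < size (H m) -> child (H m) q i = None ->
  child (H k) q i = None.
Proof.
move=> le lt E; case E': (child (H k) q i) => [a|//].
by have [b] := child_ext_inv (ext_le le) lt E'; rewrite E.
Qed.

(** The nodes of time [n] have finitely many slots, and each of these changes at most once more,
    when a [Rebuild] node is replaced. The nodes allocated between [n] and [N] never hold a
    [Rebuild] node, so their slots do not change at all. *)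
Lemma slots_static : exists2 N, n <= N & forall m q i, N <= m -> S q ->
  q < size (H N) -> child (H m) q i = child (H N) q i.
Proof.
have slot q i : q < size (H n) -> S q ->
    exists2 N, n <= N & forall m, N <= m -> child (H m) q i = child (H m.+1) q
      i.
  move=> lt_q Sq.
  case: (pselect (exists m a, [/\ n <= m, child (H m) q i = Some a & ~
    is_rebuild (H m) a])).
    case=> m [a [le Ea nr]]; exists m => // k le_k.
    by rewrite !(slot_fixed le _ Sq Ea nr) // leqW.
  move=> no; exists n => // m le; case Em: (child (H m) q i) => [a|].
    have [->//|[_ [b Eb nb]]] := slot_step le Sq Em.
    by case: no; exists m.+1, b; split=> //; apply: leqW.
  rewrite (child_none (leqnSn m) _ Em) //; exact: leq_trans lt_q (size_le le).
have node q : q < size (H n) -> exists2 N, n <= N &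
    forall m, N <= m -> S q -> forall i, child (H m) q i = child (H m.+1) q i.
  move=> lt_q; case: (pselect (S q)) => [Sq|nS]; last by exists n.
  case: (pselect (is_inner (H n) q)) => [[u E]|ni]; last first.
    exists n => // m le _ i.
    have no k : n <= k -> child (H k) q i = None.
      move=> le_k; apply: (child_none le_k lt_q); case Ei: child => [a|//].
      by case: ni; case/child_inv: Ei => u; exists u.
    by rewrite !no //; apply: leqW.
  have [N le PN] := @eventually_ltn (fun i m => child (H m) q i = child (H
    m.+1) q i)
    (degree u) n (fun i _ => slot q i lt_q Sq).
  exists N => // m le_m _ i; have [lt_i|ge_i] := ltnP i (degree u); first
    exact: PN.
  have no k : n <= k -> child (H k) q i = None.
    move=> le_k; apply: (child_none le_k lt_q).
    by rewrite (child_inner _ E); apply: onth_default.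
  by rewrite !no //; lia.
have [N le PN] := eventually_ltn node.
exists N => // m q i le_m Sq lt_q.
have [lt_qn|ge_qn] := ltnP q (size (H n)).
  move: le_m => /subnK<-; elim: (m - N) => [//|d IH].
  by rewrite addSn -(PN q (d + N) lt_qn (leq_addl _ _) Sq i).
case E: (child (H N) q i) => [a|]; last exact: child_none E.
exact: (slot_fixed le le_m Sq E (new_slot_not_rebuild le Sq ge_qn E)).
Qed.

End NoChange.

Lemma eventually_static n : (forall m t, n <= m -> ~ update_in m t) ->
  exists2 N, n <= N &
    (forall m t, N <= m -> ~ rebuild_in m t) /\
    forall m q i, N <= m -> S q ->
      q < size (H N) -> child (H m) q i = child (H N) q i.
Proof.
move=> noU; have [N1 le1 noR] := no_rebuild_in noU.
have noU1 m t : N1 <= m -> ~ update_in m t.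
  by move=> le; apply: noU; apply: leq_trans le.
have [N le st] := slots_static noU1 (fun m t => noR t m).
exists N; first exact: leq_trans le.
by split=> // m t le_m; apply: noR; apply: leq_trans le_m.
Qed.

End Static.

End Progress.

(** * Ancestry along the homes *)

Section Below.

Variable G : addr -> ghost.
Implicit Types (h : heap) (a u v : addr).

Definition below u a := exists j, ancestor G j a = u.

Lemma below_refl u : below u u.
Proof. by exists 0. Qed.

Lemma below_up u a : below u (up (G a)) -> below u a.
Proof. by case=> j E; exists j.+1; rewrite /ancestor iterSr. Qed.

Lemma below_inv u a : below u a -> u = a \/ below u (up (G a)).
Proof.
by case=> -[|j] <-; [left | right; exists j; rewrite /ancestor iterSr].
Qed.

Lemma below_trans v u a : below v u -> below u a -> below v a.
Proof.
by case=> i <- [j <-]; exists (i + j); rewrite /ancestor iterD.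
Qed.

Lemma below_root u : up (G 0) = 0 -> below u 0 -> u = 0.
Proof. by move=> u0 [j <-]; rewrite /ancestor; elim: j => //= j ->. Qed.

Lemma dead_below h u a : dead G h u -> below u a -> dead G h a.
Proof.
by case=> i d [j E]; exists (i + j); rewrite /ancestor iterD -/(ancestor G j a)
  E.
Qed.

Lemma below_path h q ns u : chain G h q ns -> below u (path_end q ns) ->
  u \in unzip1 ns \/ below u q.
Proof.
elim: ns q => [|[m j] r IH] q /=; first by right.
case=> [[_ _ [eu _ _ _]] _ _ ch] /(IH _ ch)[u_r|/below_inv[->|]].
- by left; rewrite inE u_r orbT.
- by left; rewrite inE eqxx.
- by rewrite eu; right.
Qed.

Lemma path_below h q ns u : chain G h q ns -> u \in unzip1 ns -> below q u.
Proof.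
elim: ns q => [//|[m j] r IH] q /= [[_ _ [eu _ _ _]] _ _ ch].
have qm : below q m by apply: below_up; rewrite eu; apply: below_refl.
rewrite inE => /orP[/eqP->//|/(IH _ ch)]; exact: below_trans.
Qed.

End Below.

(** * Inversion of single steps *)

Section StepInversion.

Implicit Types (h : heap) (s : pc).

Lemma incr_step_inv o h todo ns h' s' :
  op_step R o h (IncrCounts todo ns) h' s' ->
  (exists a j r, [/\ todo = (a, j) :: r, h' = fetch_and_add_count h a
     & s' = IncrCounts r ns]) \/
  [/\ todo = [::], h' = h & s' = CheckCounts 0 ns].
Proof. by move=> st; inversion st; [left; do 3 eexists | right]. Qed.

Lemma check_step_inv o h q todo h' s' :
  op_step R o h (CheckCounts q todo) h' s' -> h' = h /\
  ((exists a j r u, [/\ todo = (a, j) :: r, node_at h a = Some (Inner u),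
     (R * (init_size u)%:R <= (cnt u)%:R)%R & s' = StartRebuild a q j]) \/
   (exists a j r u, [/\ todo = (a, j) :: r, node_at h a = Some (Inner u),
     ((cnt u)%:R < R * (init_size u)%:R)%R & s' = CheckCounts a r]) \/
   (todo = [::] /\ s' = Return None)).
Proof.
move=> st; inversion st; subst; split=> //.
- by left; do 4 eexists; split; eauto.
- by right; left; do 4 eexists; split; eauto.
- by right; right.
Qed.

Lemma search_step_inv o h a h' s' :
  op_step R o h (Search a) h' s' -> h' = h /\
  ((exists u i b, [/\ node_at h a = Some (Inner u), child h a i = Some b
      & s' = Search b]) \/
   (exists r, s' = Return r) \/
   (exists t q i, node_at h a = Some (Rebuild t q i) /\ s' = Search t)).
Proof.
move=> st; inversion st; subst; split=> //.
- by left; do 3 eexists; split; eauto.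
- by right; left; eexists.
- by right; left; eexists.
- by right; right; do 3 eexists; split; eauto.
Qed.

End StepInversion.

(** * Lookups *)

Section WaitFree.

Variables (c : nat -> config) (sched : nat -> option 'I_p) (G : addr -> ghost).
Hypotheses (exec : execution R c sched) (ok : forall m, config_ok G (c m)).
Hypothesis ext1 : forall m, heap_ext (memory (c m)) (memory (c m.+1)).

Local Notation H m := (memory (c m)).
Implicit Types (t : 'I_p) (o : operation).

(** * Finiteness of the updates below an inner node *)

Section Count.

Variables (u : addr) (n : nat).
Hypotheses (u_inner : is_inner (H n) u) (u_neq0 : u <> 0).

Lemma inner_later m : n <= m -> is_inner (H m) u.
Proof. by move=> le; apply: (is_inner_ext (ext_le ext1 le)). Qed.

Lemma inner_size m : n <= m -> u < size (H m).
Proof. by move/inner_later => [w /node_at_lt]. Qed.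

Definition count_at m : nat :=
  if node_at (H m) u is Some (Inner w) then cnt w else 0.

Lemma count_mono m : count_at m <= count_at m.+1.
Proof.
rewrite /count_at; case E: (node_at (H m) u) => [[|k v|w|t q i]|] //.
by have [w' -> []] := inner_ext (@ext1 m) E.
Qed.

Lemma count_mono_le m k : m <= k -> count_at m <= count_at k.
Proof.
move/subnK<-; elim: (k - m) => [//|d IH]; rewrite addSn.
exact: leq_trans (count_mono _).
Qed.

Definition to_count (x : thread) : Prop :=
  if x is Running _ (IncrCounts todo _) then u \in unzip1 todo else False.

Lemma to_count_step m t : n <= m -> count_at m.+1 = count_at m ->
  to_count (threads (c m) t) -> to_count (threads (c m.+1) t).
Proof.
move=> le eq_cnt; case: (thread_step exec m t) => [->//|[_ tr]].
case E: (threads (c m) t) tr => [//|o [] //= todo ns] tr u_in.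
case: tr => [r o'|o' s s' [_ <-] st|o' r] //.
have [[a [j [r [Er Eh ->]]]]|[Er _ _]] := incr_step_inv st; last by rewrite Er
  in u_in.
move: u_in; rewrite Er /= inE => /orP[/eqP ua|//].
have [w Ew] := inner_later le; move: eq_cnt; rewrite /count_at Eh -ua.
rewrite /fetch_and_add_count (node_at_update _ _ Ew) eqxx Ew /=; lia.
Qed.

Lemma update_path m t : update_in c (below G u) m t ->
  exists o ns, threads (c m.+1) t = Running o (IncrCounts ns ns) /\
    u \in unzip1 ns.
Proof.
case=> o [ns [k [i [a [E E' bu]]]]]; exists o, ns; split=> //.
have [_ ch en _] := thread_okm ok E; rewrite en in bu.
have [//|] := below_path ch bu.
by case: (heap_okm ok m) => _ u0 _ _ _ /(below_root u0).
Qed.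

(* The thread will have to start a rebuilding of [u] or of a node above [u],
   once the count of [u] exceeds the threshold. *)
Definition to_rebuild (x : thread) : Prop :=
  match x with
  | Running _ (IncrCounts _ ns) => u \in unzip1 ns
  | Running _ (CheckCounts _ todo) => u \in unzip1 todo
  | Running _ (StartRebuild a _ _) => below G a u
  | _ => False
  end.

Definition full (m : nat) : Prop := forall w, node_at (H m) u = Some (Inner w)
  ->
  (R * (init_size w)%:R <= (cnt w)%:R)%R.

Lemma to_rebuild_step m t : full m -> to_rebuild (threads (c m) t) ->
  to_rebuild (threads (c m.+1) t) \/ dead G (H m.+1) u.
Proof.
move=> fl; case: (thread_step exec m t) => [->|[_ tr]]; first by left.
case E: (threads (c m) t) tr => [//|o s0] tr; move: E.
case: tr => [r o'|o' s s' [<- <-] st|o' r [_ ->]] // E.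
have tok := thread_okm ok E.
case: s0 E st tok => //= [todo ns|q todo|a q i] E st tok u_in.
- by left; have [[a [j [r [_ _ ->]]]]|[_ _ ->]] := incr_step_inv st.
- have [_ [[a [j [r [w [Er Ew _ ->]]]]]|[[a [j [r [w [Er Ew lt ->]]]]]|[Er
    _]]]] :=
    check_step_inv st; last by rewrite Er in u_in.
    left; case: tok; rewrite Er => _ [_ _ _ ch].
    move: u_in; rewrite Er inE => /orP[/eqP->|]; first exact: below_refl.
    exact: path_below ch.
  left; move: u_in; rewrite Er inE => /orP[/eqP ua|//].
  by have := fl w; rewrite ua Ew => /(_ erefl); rewrite leNgt lt.
- right; apply: dead_below u_in.
  exact: start_rebuild_dead tok (heap_okm ok _) (@ext1 m) st.
Qed.

Lemma update_not_to_count m t : update_in c (below G u) m t ->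
  ~ to_count (threads (c m) t).
Proof. by case=> o [ns [k [i [a [-> _ _]]]]]. Qed.

Lemma update_not_to_rebuild m t : update_in c (below G u) m t ->
  ~ to_rebuild (threads (c m) t).
Proof. by case=> o [ns [k [i [a [-> _ _]]]]]. Qed.

Variable t : 'I_p.
Hypothesis infinite : forall N, exists2 m, N <= m & update_in c (below G u) m t.

(** A bounded count would be stable from some time on. After its next update below [u] the thread
    could then never leave [to_count], since this takes an increment of the count; but yet another
    update starts outside [to_count]. *)
Lemma count_unbounded B : exists2 m, n <= m & B <= count_at m.
Proof.
case: (pselect (exists m, B <= count_at m)) => [[m le]|no].
  exists (maxn n m); first exact: leq_maxl.
  by apply: leq_trans le (count_mono_le _); apply: leq_maxr.
have [m|N stable] := bounded_stable count_mono (B := B).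
  by rewrite ltnNge; apply/negP => le; apply: no; exists m.
have [m1 le1 upd1] := infinite (maxn n N).
have pers d : to_count (threads (c (m1.+1 + d)) t).
  elim: d => [|d IH].
    by rewrite addn0; have [o [ns [-> u_in]]] := update_path upd1.
  by rewrite addnS; apply: to_count_step IH; [lia|rewrite !stable //; lia].
have [m2 le2 upd2] := infinite m1.+1.
by case: (update_not_to_count upd2); rewrite -(subnKC le2); apply: pers.
Qed.

(** The threshold is fixed, because [init_size] is immutable, and the field is Archimedean. *)
Lemma full_eventually : exists2 N, n <= N & forall m, N <= m -> full m.
Proof.
have [w0 Ew0] := u_inner.
pose x := (R * (init_size w0)%:R)%R.
have [N le cN] := count_unbounded (Num.bound `|x|%R).
exists N => // m le_m w Ew.
have [w' Ew' [ei _ _ _ _]] := inner_ext (ext_le ext1 (leq_trans le le_m)) Ew0.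
move: Ew'; rewrite Ew => -[ew]; rewrite ew ei -/x.
have : Num.bound `|x|%R <= cnt w'.
  by have := leq_trans cN (count_mono_le le_m); rewrite /count_at Ew ew.
rewrite -(ler_nat F) => /(le_trans _) -> //.
by apply: le_trans (ler_norm x) _; apply: ltW; apply: archi_boundP; apply:
  normr_ge0.
Qed.

(** Only descending states matter: a path is extended by reading a slot, and a detached node is no
    longer in its home. *)
Definition avoids (v : addr) (x : thread) : Prop :=
  match x with
  | Running _ (Descend ns _) => v \notin unzip1 ns
  | Running _ (Update ns _ _ _) => v \notin unzip1 ns
  | _ => True
  end.

Lemma avoids_step v m : detached G (H m) v ->
  avoids v (threads (c m) t) -> avoids v (threads (c m.+1) t).
Proof.
move=> dv; apply: (thread_inv exec) => x' av tr _.
case: tr av => [r o _|o s s' -> st|o r _] //; first by case: o.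
case: st => //=.
move=> ns k w i a w' Ek Ei Ea _; rewrite /unzip1 map_rcons mem_rcons inE
  negb_or => ->.
rewrite andbT; apply/eqP => va; case: dv => _; rewrite va.
case: (child_belongs (heap_okm ok m) Ea) => _ _ [-> -> _ _].
by case=> b; rewrite Ea => -[->]; rewrite ltnn.
Qed.

(** Three updates of the thread suffice once the count is above the threshold: the first one leads
    to the death of [u] before the second, and no path begun after the second contains the detached
    node that the path of the third has to cross. *)
Lemma updates_finite : False.
Proof.
have [N le fl] := full_eventually.
have [m1 le1 upd1] := infinite N; have [m2 le2 upd2] := infinite m1.+1.
have main d : to_rebuild (threads (c (m1.+1 + d)) t) \/ dead G (H (m1.+1 + d))
  u.
  elim: d => [|d [IH|IH]].
  - by rewrite addn0; have [o [ns [-> u_in]]] := update_path upd1; left.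
  - by rewrite addnS; apply: to_rebuild_step IH; apply: fl; lia.
  - rewrite addnS; right; apply: (dead_le ok ext1 (leqnSn _) _ IH).
    by apply: inner_size; lia.
have := main (m2 - m1.+1); rewrite subnKC // => -[|[j dv]].
  exact: update_not_to_rebuild.
(* [v] is [u] or the ancestor of [u] whose detachment makes [u] dead. Right after the update at [m2]
   the thread is not descending, so that it avoids [v] trivially. *)
set v := ancestor G j u in dv.
have lt_v : v < size (H m2).
  by apply: (ancestor_lt (heap_closed (heap_okm ok m2))); apply: inner_size;
    lia.
have [m3 le3 upd3] := infinite m2.+1.
have av d : avoids v (threads (c (m2.+1 + d)) t).
  elim: d => [|d IH].
    by rewrite addn0; have [o [ns [-> _]]] := update_path upd2.
  rewrite addnS; apply: avoids_step IH.
  apply: (detached_ext (ext_le ext1 _) _ lt_v dv) => //; lia.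
have := av (m3 - m2.+1); rewrite subnKC //.
case: upd3 => o [ns [k [i [a [E _ bu]]]]]; rewrite E /=.
have [_ ch en _] := thread_okm ok E; rewrite en in bu.
have bv : below G v (path_end 0 ns) by apply: below_trans bu; exists j.
have [->//|] := below_path ch bv.
by case: (heap_okm ok m3) => _ u0 _ _ _ /(below_root u0); case: dv.
Qed.

End Count.

(** The root must be excluded: it lies on no path, and the updates below it may go on forever. *)
Lemma no_update_below u n : is_inner (H n) u -> u <> 0 ->
  exists2 N, n <= N & forall t m, N <= m -> ~ update_in c (below G u) m t.
Proof.
move=> iu u0; apply: eventually_fin => t.
case: (pselect (forall N, exists2 m, N <= m & update_in c (below G u) m t)) =>
  [inf|].
  by case: (updates_finite iu u0 inf).
move/existsNP => [N no]; exists (maxn n N); first exact: leq_maxl.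
move=> m; rewrite geq_max => /andP[_ le] upd; apply: no; by exists m.
Qed.

(** * Termination of a lookup *)

Section Lookup.

Variables (t : 'I_p) (o : operation) (n : nat).
Hypotheses (o_lookup : is_lookup o) (inf : taken_forever sched t).
Hypothesis pending : forall m, n <= m -> exists s, threads (c m) t = Running o
  s.

Lemma search_step m a : n <= m -> sched m = Some t ->
  threads (c m) t = Running o (Search a) ->
  [\/ exists u i b, [/\ node_at (H m) a = Some (Inner u),
        child (H m) a i = Some b & threads (c m.+1) t = Running o (Search b)],
      exists r, threads (c m.+1) t = Running o (Return r)
    | exists b q i, node_at (H m) a = Some (Rebuild b q i) /\
        threads (c m.+1) t = Running o (Search b)].
Proof.
move=> le Es E; have := sched_trans exec Es; rewrite E.
case Ex: _ / => [r o' //|o' s s' [eo es] st|o' r //].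
move: st; rewrite -eo -es => st.
have [_ [[u [i [b [Ea Eb ->]]]]|[[r ->]|[b [q [i [Ea ->]]]]]]] :=
  search_step_inv st.
- by constructor 1; exists u, i, b.
- by constructor 2; exists r.
- by constructor 3; exists b, q, i.
Qed.

Lemma not_return m r : n <= m -> threads (c m) t <> Running o (Return r).
Proof.
move=> le E; have [m' [le' Es Et]] := next_step exec m inf.
have := sched_trans exec Es; have [|s ->] := pending (m := m'.+1); first by lia.
rewrite Et E; case Ex: _ / => [r' o' //|o' s0 s' [_ <-] st|//].
by inversion st.
Qed.

(** The search stays below [u], where the slots are eventually constant: a [Rebuild] node met there
    is not [u] itself, which is Inner, and its target has the same parent. *)
Lemma search_inner_false m u : n <= m -> threads (c m) t = Running o (Search u)
  ->
  is_inner (H m) u -> u <> 0 -> False.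
Proof.
move=> le E iu u0; have [N1 le1 noU] := no_update_below iu u0.
have [N le2 [_ static]] := eventually_static exec ok ext1 (S := below G u)
  (@below_up _ _) (fun m t => noU t m).
have pers d : exists2 a, threads (c (m + d)) t = Running o (Search a) & below G
  u a.
  elim: d => [|d [a Ea ba]]; first by exists u; rewrite ?addn0 //; apply:
    below_refl.
  rewrite addnS; have le_m : n <= m + d by lia.
  case: (thread_step exec (m + d) t) => [->|[Es _]]; first by exists a.
  have [[w [i [b [_ Eb Et]]]]|[r /not_return[]]|[b [q [i [Er Et]]]]] :=
    search_step le_m Es Ea; last 1 first.
  - exists b => //; have [_ _ bb _ ba'] := node_okP (heap_okm ok _) Er.
    case: bb => _ _ [eu _ _ _]; case: ba' => _ _ [ea _ _ _].
    case: (below_inv ba) => [ua|]; last by rewrite ea -eu; apply: below_up.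
    have [w Ew] := is_inner_ext (ext_le ext1 (leq_addr d m)) iu.
    by rewrite ua Er in Ew.
  - exists b => //; apply: below_up.
    by case: (child_belongs (heap_okm ok _) Eb) => _ _ [-> _ _ _].
  - by lia.
have le_mN : m <= N := leq_trans le1 le2.
pose D := \max_(i < size (H N)) dep (G i).
have le_D a : a < size (H N) -> dep (G a) <= D.
  by move=> lt_a; apply: (leq_bigmax (Ordinal lt_a)).
(* A step from a [Rebuild] node to its target keeps the depth but reaches an Inner node; doubling
   the remaining depth leaves room for this extra unit. *)
pose rb a : nat := if node_at (H N) a is Some (Rebuild _ _ _) then 1 else 0.
pose mu (x : thread) := if x is Running _ (Search a)
  then (D - dep (G a)).*2 + rb a else 0.
pose Q (x : thread) := exists a,
  [/\ x = Running o (Search a), below G u a & a < size (H N)].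
apply: (@measure_false _ _ exec t N Q mu) => //.
  have [a Ea ba] := pers (N - m); rewrite subnKC // in Ea.
  exists a; split=> //; have [_ //] := thread_okm ok Ea.
move=> k le_k Es [a [Ea ba lt_a]].
have le_nk : n <= k by lia.
have extNk := ext_le ext1 le_k.
have [[w [i [b [Ew Eb Et]]]]|[r /not_return[]]|[b [q [i [Er Et]]]]] :=
  search_step le_nk Es Ea; last 1 first.
- have ErN := rebuild_ext_inv extNk lt_a Er.
  have [lt_ba [w Ew] bb _ ba'] := node_okP (heap_okm ok N) ErN.
  have eqd : dep (G b) = dep (G a).
    by case: bb => _ _ [_ _ -> _]; case: ba' => _ _ [_ _ -> _].
  rewrite Ea Et /= eqd /rb ErN Ew; split; last by lia.
  exists b; split=> //; last exact: ltn_trans lt_a.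
  case: bb => _ _ [eu _ _ _]; case: ba' => _ _ [ea _ _ _].
  case: (below_inv ba) => [ua|]; last by rewrite ea -eu; apply: below_up.
  have [w' Ew'] := is_inner_ext (ext_le ext1 le_mN) iu.
  by rewrite ua ErN in Ew'.
- have [w' Ew' _] := inner_ext_inv extNk lt_a Ew.
  have EbN : child (H N) a i = Some b by rewrite -(static k).
  have [lt_b _ [eu _ ed _]] := child_belongs (heap_okm ok N) EbN.
  have := le_D _ lt_b; rewrite Ea Et /= /rb Ew' ed => leD; split.
    exists b; split=> //; apply: below_up; by rewrite eu.
  by case: (node_at _ b) => [[]|]; lia.
- by lia.
Qed.

Lemma search_nonroot_false m a : n <= m -> threads (c m) t = Running o (Search
  a) ->
  a <> 0 -> False.
Proof.
move=> le E a0; have [m' [le' Es Et]] := next_step exec m inf.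
rewrite E in Et; have le_n := leq_trans le le'.
have [[w [i [b [Ew Eb _]]]]|[r /not_return[]]|[b [q [i [Er Eb]]]]] :=
  search_step le_n Es Et; last 1 first.
- have [_ ib [_ b0 _] _ _] := node_okP (heap_okm ok m') Er.
  apply: (search_inner_false _ Eb _ b0); first exact: leqW.
  by apply: (is_inner_ext _ ib); apply: ext1.
- by apply: (search_inner_false le_n Et _ a0); exists w.
- exact: leqW.
Qed.

(** The slot of the root may change forever, but a search at the root leaves it in one step and then
    meets only nodes other than the root. *)
Lemma lookup_false : False.
Proof.
have [s E] := pending (leqnn n); have tok := thread_okm ok E.
have upd : is_update o -> False by case: (o) o_lookup.
case: s E tok => [ns k|ns k i a|todo ns|q todo|a q i|op k s|a|r] E /=.
- by case=> /upd.
- by case=> /upd.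
- by case=> /upd.
- by case=> /upd.
- by case=> /upd.
- by case=> /upd.
- move=> _; have [m' [le' Es Et]] := next_step exec n inf.
  rewrite E in Et.
  have [[w [i [b [Ew Eb Ebt]]]]|[r /not_return[]]|[b [q [i [Er Eb]]]]] :=
    search_step le' Es Et; last 1 first.
  + have [_ _ [_ b0 _] _ _] := node_okP (heap_okm ok m') Er.
    exact: (search_nonroot_false (leqW le') Eb b0).
  + case: (child_belongs (heap_okm ok m') Eb) => _ b0 _.
    exact: (search_nonroot_false (leqW le') Ebt b0).
  + exact: leqW.
- by move=> _; case: (not_return (leqnn n) E).
Qed.

End Lookup.

End WaitFree.

Lemma lookup_wait_free : wait_free R p (@is_lookup disp K V).
Proof.
split; first exact: never_stuck_any.
move=> c sched exec t n [o [s [E lo]]] inf.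
have [G [ok ext1]] := execution_config_ok exec.
apply/not_existsP => no.
have pending m : n <= m -> exists s, threads (c m) t = Running o s.
  move/subnK<-; elim: (m - n) => [|d [s' Es]]; first by exists s.
  rewrite addSn; case: (thread_step exec (d + n) t) => [->|[Et tr]]; first by
    exists s'.
  have [x Ex] : exists x, threads (c (d + n).+1) t = x by eexists.
  rewrite Ex Es in tr *; case: tr Ex => [r o'|o' s1 s2|o' r] //.
    by case=> <- _ _ _; exists s2.
  move=> _ Er; case: (no (d + n)); split; first exact: leq_addl.
  by split=> //; [exists o, s' | exists r].
exact: (lookup_false exec ok ext1 lo inf pending).
Qed.

(** * Updates in a tree with constant slots *)

Section Weight.

Variables (G : addr -> ghost) (h0 : heap).
Hypothesis hok0 : heap_ok G h0.

Definition max_dep := \max_(i < size h0) dep (G i).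

Definition deg (a : addr) : nat :=
  if node_at h0 a is Some (Inner u) then degree u else 0.

(* Decreases along the edges to the children and from a Rebuild node to its
   target, which are at the same depth. *)
Definition level (a : addr) : nat :=
  (max_dep - dep (G a)).*2 +
  (if node_at h0 a is Some (Rebuild _ _ _) then 1 else 0).

(* Large enough for a node to outweigh all its children together. *)
Definition base : nat := 10 + 5 * \max_(i < size h0) deg i.

Definition weight (a : addr) : nat := base ^ (level a).+1.

(** For each remaining child, [base ^ level a] bounds its weight, as its level is smaller, and 4
    pays for the transitions around its visit. The leading 1 pays for the exit from the loop. *)
Definition loop_weight (a : addr) (i : nat) : nat :=
  1 + (deg a - i) * (4 + base ^ level a).

Fixpoint frames_weight (stk : seq frame) : nat :=
  if stk is (a, i, _) :: r then loop_weight a i.+1 + 1 + frames_weight r else 0.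

Definition mark_weight (m : mark_pc) : nat :=
  match m with
  | MarkCall a stk => weight a + frames_weight stk
  | MarkLoop a i _ stk => loop_weight a i + frames_weight stk
  | MarkStatus b a i _ stk =>
      weight b + loop_weight a i.+1 + 2 + frames_weight stk
  | MarkReturn _ stk => frames_weight stk
  end.

Fixpoint visit_weight (stk : seq (addr * nat)) : nat :=
  if stk is (a, i) :: r then loop_weight a i + visit_weight r else 0.

Definition collect_weight (c : collect_pc) : nat :=
  match c with
  | Visit a stk _ => weight a + visit_weight stk
  | Collect stk _ => visit_weight stk
  end.

Definition max_weight := base ^ (max_dep.*2 + 2).

(** One [max_weight] is for the marking, the other for the collection of the pairs; both traverse
    the same target. *)
Definition help_weight (s : help_pc) : nat :=
  match s with
  | HelpStart => 2 * max_weight + 30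
  | HelpMark m => max_weight + 20 + mark_weight m
  | HelpCreate _ c => 10 + collect_weight c
  | Install _ => 5
  | HelpDone => 1
  end.

Definition descend_weight (n : addr) : nat :=
  2 * max_weight + 40 + 10 * level n.

(** An [Update] that expects an outdated child may return to [Descend] at the same node, so it must
    weigh more than this state. With the current child this failure is impossible, and the weight
    can drop to 5. *)
Definition pc_weight (s : pc) : nat :=
  match s with
  | Descend _ n => descend_weight n
  | Update _ n i a => if child h0 n i == Some a then 5 else descend_weight n + 5
  | IncrCounts todo ns => size todo + size ns + 6
  | CheckCounts _ todo => size todo + 3
  | StartRebuild _ _ _ => 2
  | Help _ _ s => help_weight s
  | _ => 0
  end.

(* Operations in such a state do not restart. *)
Definition safe (s : pc) : Prop :=
  match s with
  | Descend _ n => ~ dead G h0 n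
  | Update _ n i a => ~ dead G h0 n /\ child h0 n i = Some a
  | Help _ Restart HelpDone => False
  | Help op Restart _ =>
      exists q i, child h0 q i = Some op /\ ~ dead G h0 q
  | _ => True
  end.

(** The supplement of an unsafe state exceeds the weight of [Descend] at the root, which is safe. It
    thus pays for the only restart there can be, since safety is never lost. *)
Definition total_weight (s : pc) : nat :=
  pc_weight s + (if pselect (safe s) then 0
                 else 2 * max_weight + 60 + 10 * (max_dep.*2 + 2)).

Notation known a := (a < size h0).

(** The slots are constant only in nodes already allocated in [h0], so the weight is meaningful only
    for states that stay among these. *)
Definition mark_known (m : mark_pc) : bool :=
  match m with
  | MarkCall a stk => known a && all (fun f : frame => known f.1.1) stk
  | MarkLoop a _ _ stk => known a && all (fun f : frame => known f.1.1) stk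
  | MarkStatus b a _ _ stk =>
      [&& known b, known a & all (fun f : frame => known f.1.1) stk]
  | MarkReturn _ stk => all (fun f : frame => known f.1.1) stk
  end.

Definition collect_known (c : collect_pc) : bool :=
  match c with
  | Visit a stk _ => known a && all (fun f : addr * nat => known f.1) stk
  | Collect stk _ => all (fun f : addr * nat => known f.1) stk
  end.

Definition help_known (s : help_pc) : bool :=
  match s with
  | HelpMark m => mark_known m
  | HelpCreate _ c => collect_known c
  | _ => true
  end.

Definition pc_known (s : pc) : bool :=
  match s with
  | Descend _ n => known n
  | Update _ n _ _ => known n
  | Help op _ s => known op && help_known s
  | _ => true
  end.

Lemma thread_ok_known o s : thread_ok G h0 o s -> pc_known s.
Proof.
have frames stk : frames_ok G h0 stk -> all (fun f : frame => known f.1.1) stk.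
  by elim: stk => [//|[[a i] k] r IH] /= [[u /node_at_lt -> _] /IH].
have visits t (P : K -> Prop) stk (kvs : seq (K * V)) :
    collect_frames G h0 t P stk kvs -> all (fun f : addr * nat => known f.1)
      stk.
  elim: stk P => [//|[a i] r IH] P /= [u /node_at_lt -> [_ _ _ _]]; exact: IH.
case: s => //= [ns n|ns n i a|op k s].
- by case=> _ _ _ /is_inner_lt.
- by case=> _ _ _ [/is_inner_lt].
- case=> _ [t [q [i [/node_at_lt-> _]]]]; case: s => //= [m|n c].
    case: m => [a stk|a j n stk|b a j n stk|n stk] /=.
    + by case=> -> _ _ /frames.
    + by case=> -[u /node_at_lt-> _] /frames.
    + by case=> /is_inner_lt -> _ [u /node_at_lt-> _] /frames.
    + exact: frames.
  case: c => [a stk kvs|stk kvs] /=.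
    by case=> -> _ _ _ /visits.
  by case=> _ _ /visits.
Qed.

(** * Decrease of the weight in one step *)

Section Step.

Variables (h h' : heap).
Hypotheses (hok : heap_ok G h) (ext0 : heap_ext h0 h).
Hypothesis same : forall q i, known q -> child h q i = child h0 q i.
Hypothesis same' : forall q i, known q -> child h' q i = child h0 q i.

Lemma base_gt1 : 1 < base.
Proof. by rewrite /base; lia. Qed.

Lemma expn_gt0_base n : 0 < base ^ n.
Proof. by rewrite expn_gt0; apply/orP; left; apply: ltnW base_gt1. Qed.

Lemma dep_le a : known a -> dep (G a) <= max_dep.
Proof. by move=> lt_a; apply: (leq_bigmax (Ordinal lt_a)). Qed.

Lemma deg_le a : known a -> 5 * deg a + 10 <= base.
Proof.
move=> lt_a; have := leq_bigmax (F := fun i : 'I_(size h0) => deg i) (Ordinal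
  lt_a).
by rewrite /base /=; lia.
Qed.

Lemma level_le a : level a <= max_dep.*2 + 1.
Proof.
by rewrite /level; case: (node_at h0 a) => [[|k v|u|t q i]|]; lia.
Qed.

Lemma weight_le a : weight a <= max_weight.
Proof.
rewrite leq_exp2l ?base_gt1 //; have := level_le a; lia.
Qed.

Lemma known_inner a u : known a -> node_at h a = Some (Inner u) ->
  deg a = degree u /\ (exists2 u0, node_at h0 a = Some (Inner u0) & keys u0 =
    keys u).
Proof.
move=> lt_a /(inner_ext_inv ext0 lt_a)[u0 E [_ ek es _ _]].
by rewrite /deg E /degree es; split=> //; exists u0.
Qed.

Lemma level_inner a u : known a -> node_at h a = Some (Inner u) ->
  level a = (max_dep - dep (G a)).*2.
Proof.
move=> lt_a /(known_inner lt_a)[_ [u0 E _]].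
by rewrite /level E addn0.
Qed.

Lemma child_known a i b : known a -> child h a i = Some b ->
  [/\ known b, level b < level a & weight b <= base ^ level a].
Proof.
move=> lt_a Eb; have [u Eu _] := child_inv Eb.
have Eb0 : child h0 a i = Some b by rewrite -same.
have [lt_b _ [_ _ ed _]] := child_belongs hok0 Eb0.
have ltl : level b < level a.
  rewrite (level_inner lt_a Eu); have := dep_le lt_b; rewrite /level ed.
  by case: (node_at h0 b) => [[|k v|u'|t q j]|]; lia.
by split=> //; rewrite leq_exp2l ?base_gt1.
Qed.

Lemma loop_child a i b : known a -> child h a i = Some b ->
  loop_weight a i = loop_weight a i.+1 + 4 + base ^ level a.
Proof.
move=> lt_a /child_inv[u Eu /onth_lt lt_i].
have [ed _] := known_inner lt_a Eu; rewrite /loop_weight ed.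
rewrite -[children u]/(children u) in lt_i.
have -> : degree u - i = (degree u - i.+1).+1 by rewrite /degree; lia.
by rewrite mulSn; lia.
Qed.

(** With x = [base ^ level a] >= 1 and d the degree, d (4 + x) <= 5 d x; this is the origin of the
    factor 5 in [base]. *)
Lemma loop_start a : known a -> loop_weight a 0 + 1 < weight a.
Proof.
move=> lt_a; have := deg_le lt_a; have := expn_gt0_base (level a).
rewrite /loop_weight /weight expnS subn0; move: (base ^ level a) (deg a) => x d.
nia.
Qed.

Lemma loop_end a u : known a -> node_at h a = Some (Inner u) ->
  loop_weight a (degree u) = 1.
Proof.
by move=> lt_a /(known_inner lt_a)[ed _]; rewrite /loop_weight ed subnn.
Qed.

Lemma target_known a t q i : known a -> node_at h a = Some (Rebuild t q i) ->
  [/\ known t, is_inner h0 t & weight t < weight a].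
Proof.
move=> lt_a /(rebuild_ext_inv ext0 lt_a) E.
have [lt it [_ _ [_ _ dt _]] _ [_ _ [_ _ da _]]] := node_okP hok0 E.
split=> //; first exact: ltn_trans lt_a.
rewrite ltn_exp2l ?base_gt1 // /level E; case: it => u ->; rewrite dt da; lia.
Qed.

Lemma weight_gt0 a : 0 < weight a.
Proof. exact: expn_gt0_base. Qed.

Lemma mark_step_weight m h2 m' : mark_known m -> mark_step h m h2 m' ->
  mark_known m' /\ mark_weight m' < mark_weight m.
Proof.
move=> kn st; move: kn.
case: st => [a stk E|a stk k v E|a stk t q i E|a stk w E
  |a i n stk c Ec E|a i n stk c k v Ec E|a i n stk c t q j Ec E|a i n stk c w
    Ec E
  |c a i n stk m1 b E|c a i n stk m1 b E|a n stk w E|m1 a i n stk] /=.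
- by case/andP => _ ->; have := weight_gt0 a; split=> //; lia.
- by case/andP => _ ->; have := weight_gt0 a; split=> //; lia.
- case/andP => lt_a ->; have [-> _ lt] := target_known lt_a E.
  by split=> //; lia.
- case/andP => lt_a ->; have lt := loop_start lt_a; rewrite lt_a; split=> //;
    lia.
- case/andP => lt_a ->; rewrite lt_a (loop_child lt_a Ec); split=> //; lia.
- case/andP => lt_a ->; rewrite lt_a (loop_child lt_a Ec); split=> //; lia.
- case/andP => lt_a ->; have [-> _ le] := child_known lt_a Ec.
  by rewrite lt_a (loop_child lt_a Ec); split=> //; lia.
- case/andP => lt_a ->; have [-> _ le] := child_known lt_a Ec.
  by rewrite lt_a (loop_child lt_a Ec); split=> //; lia.
- by case/and3P => lt_c -> ->; split=> //; lia.
- by case/and3P => -> -> ->; split=> //; lia.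
- case/andP => lt_a ->; rewrite (loop_end lt_a E); split=> //; lia.
- by case/andP => -> ->; split=> //; lia.
Qed.

Lemma collect_step_weight c c' : collect_known c -> collect_step h c c' ->
  collect_known c' /\ collect_weight c' < collect_weight c.
Proof.
move=> kn st; move: kn.
case: st => [a stk kvs E|a stk kvs k v E|a stk kvs t' q i E|a stk kvs w E
  |a i stk kvs c1 Ec|a stk kvs w E] /=.
- by case/andP => _ ->; have := weight_gt0 a; split=> //; lia.
- by case/andP => _ ->; have := weight_gt0 a; split=> //; lia.
- case/andP => lt_a ->; have [-> _ lt] := target_known lt_a E.
  by split=> //; lia.
- case/andP => lt_a ->; have lt := loop_start lt_a; rewrite lt_a; split=> //;
    lia.
- case/andP => lt_a ->; have [-> _ le] := child_known lt_a Ec.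
  by rewrite lt_a (loop_child lt_a Ec); split=> //; lia.
- by case/andP => lt_a ->; rewrite (loop_end lt_a E); split=> //; lia.
Qed.

Lemma help_step_weight op s h2 s' : known op -> help_known s ->
  help_step op h s h2 s' -> help_known s' /\ help_weight s' < help_weight s.
Proof.
move=> lt_op kn st; move: kn.
case: st => [t q i E|m h1 m' st|n t q i E|n c c' st|n kvs h1 a nid
  |a t q i r h1 E dc] /= kn.
- have [-> _ _] := target_known lt_op E; split=> //.
  by have := weight_le t; lia.
- by have [-> lt] := mark_step_weight kn st; split=> //; lia.
- have [-> _ _] := target_known lt_op E; split=> //.
  by have := weight_le t; lia.
- by have [-> lt] := collect_step_weight kn st; split=> //; lia.
- by split=> //; lia.
- by [].
Qed.

(** Deadness depends on slots of known nodes alone, and these are the same in [h] and [h0]. *)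
Lemma dead_back a : known a -> dead G h a -> dead G h0 a.
Proof.
move=> lt_a [j d]; exists j.
have lt_v : known (ancestor G j a) by apply: ancestor_lt => //; exact:
  heap_closed.
case: d => v0 [b Eb lt]; split=> //; exists b => //.
by rewrite -same //; apply: heap_closed.
Qed.

Lemma child_alive a i b : child h0 a i = Some b -> ~ dead G h0 a -> ~ dead G h0
  b.
Proof.
move=> Eb al [[|j] d]; have [_ _ [eu ei _ _]] := child_belongs hok0 Eb.
  by case: d => _ [b' ]; rewrite eu ei Eb => -[<-]; rewrite ltnn.
by apply: al; exists j; move: d; rewrite /ancestor iterSr eu.
Qed.

Lemma alive_clean a st : known a -> ~ dead G h0 a -> status_at h a = Some st ->
  st = clean.
Proof.
move=> lt_a al; rewrite /status_at.
case E: (node_at h a) => [[|k v|u|t q i]|] // [<-].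
have [_ _ ds] := node_okP hok E; apply: contrapT => ns.
by apply: al; apply: dead_back (ds ns).
Qed.

Lemma root_safe : safe (Descend [::] ist_root).
Proof. exact: root_not_dead hok0. Qed.

Lemma root_known : known ist_root.
Proof. exact: heap_size_gt0 hok0. Qed.

Lemma total_weight_root s : ~ safe s ->
  total_weight (Descend [::] ist_root) < total_weight s.
Proof.
move=> ns; rewrite /total_weight.
case: (pselect (safe (Descend [::] ist_root))) => [al|[]] /=; last exact:
  root_safe.
case: (pselect (safe s)) => // ns' /=; rewrite /descend_weight; have :=
  level_le ist_root; lia.
Qed.

Lemma total_weight_safe s s' : (safe s -> safe s') -> pc_weight s' < pc_weight
  s ->
  total_weight s' < total_weight s.
Proof.
move=> sf lt; rewrite /total_weight; case: (pselect (safe s')) => [sf'|ns] /=.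
  by rewrite addn0; apply: leq_trans lt _; apply: leq_addr.
by case: (pselect (safe s)) => [/sf //|ns'] /=; rewrite ltn_add2r.
Qed.

Lemma op_step_weight o s s' : is_update o -> thread_ok G h o s -> pc_known s ->
  op_step R o h s h' s' ->
  (forall ns n i a, s = Update ns n i a -> s' <> IncrCounts ns ns) ->
  (forall a q i op, s = StartRebuild a q i -> s' <> Help op Finish HelpStart) ->
  pc_known s' /\ total_weight s' < total_weight s.
Proof.
move=> uo + + st; move: same'.
case: st => [ns n u i c w En Ei Ec E|ns n u i c t q j En Ei Ec E
  |ns n u i c x En Ei Ec E lx|ns n i c x E nr|ns n i c x h1 r h2 E Er dc
  |ns n i c x h1 r h2 E Er dc|ns n i c x h1 r h2 E Er dc|m j todo ns|ns
  |q m j todo u E le|q m j todo u E lt|q|a q i h1 dc|a q i r h1 dc nr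
  |op k s1 h1 s1' st|op|op|n u c E Ec|n k v E|n E|n t q i E];
  move=> sm tok /= kn noU noR.
- have [lt_c lt _] := child_known kn Ec; split=> //.
  apply: total_weight_safe => /=; last by rewrite /descend_weight; lia.
  by apply: (@child_alive _ i); rewrite -same.
- have [lt_c _ _] := child_known kn Ec; rewrite lt_c; split=> //.
  apply: total_weight_safe => /=; last by rewrite /descend_weight; lia.
  by move=> al; exists n, i; rewrite -same.
- split=> //; apply: total_weight_safe => /=; first by rewrite -same.
  by rewrite -same // Ec eqxx /descend_weight; lia.
- split=> //; apply: total_weight_safe => //=.
  by case: eqP => _ //; lia.
- by case: (noU _ _ _ _ erefl).
- have [_ _ _ [_ _ _ rk]] := tok.
  have [[l h1E] _] := new_replacement_cat hok E rk Er.
  have ne : child h0 n i <> Some c.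
    have lt_n : n < size h by apply: leq_trans kn (heap_ext_size ext0).
    by rewrite -same // -(child_cat l i lt_n) -h1E; inversion dc.
  split=> //; apply: total_weight_safe => /=; first by case.
  by case: eqP => [/ne//|_]; lia.
- have [_ _ _ [_ _ _ rk]] := tok.
  have [[l h1E] _] := new_replacement_cat hok E rk Er.
  have ne : status_at h n <> Some clean.
    have lt_n : n < size h by apply: leq_trans kn (heap_ext_size ext0).
    by rewrite -(status_at_cat l lt_n) -h1E; inversion dc.
  split; first exact: root_known.
  (* A status that is not clean makes [n] dead, so the state is not safe and its supplement pays for
     the restart. *)
  apply: total_weight_root => -[al Ec]; apply: ne.
  have [u Eu] : is_inner h n by case: tok => _ _ _ [].
  have Es : status_at h n = Some (stat u) by rewrite /status_at Eu.
  by rewrite Es (alive_clean kn al Es).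
- by split=> //; apply: total_weight_safe => //=; lia.
- by split=> //; apply: total_weight_safe => //=; lia.
- by split=> //; apply: total_weight_safe => //=; lia.
- by split=> //; apply: total_weight_safe => //=; lia.
- by split=> //; apply: total_weight_safe => //=; lia.
- by case: (noR a q i (size h) erefl).
- by split=> //; apply: total_weight_safe => //=; lia.
- case/andP: kn => lt_op kn.
  have [kn' lt] := help_step_weight lt_op kn st; rewrite lt_op; split=> //.
  (* The case that needs an argument is an installation by a safe helper about to restart, and it
     cannot occur: the slot still holds [op] and the status of the parent is clean, so that the DCSS
     cannot fail, while its success would change a constant slot. *)
  apply: total_weight_safe => //; case: k {noU noR} tok => //= -[_ ho] sf.
  case: st sm ho sf {kn kn' lt} => //= a t q i r h2 E dc sm.
  case=> t' [q' [i' [E' _ [_ lt_a _]]]] [q2 [i2 [Eop al]]].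
  have lt_q := child_lt Eop.
  have Eoph : child h q2 i2 = Some op by rewrite same.
  have [eq ei] := child_rebuild hok Eoph E; rewrite {}eq {}ei in dc.
  have [ea|//|ns] := dcss_cases dc.
    have := sm q2 i2 lt_q; rewrite ea (child_set_child _ _ _ Eoph) !eqxx Eop =>
      -[eop].
    by rewrite eop ltnn in lt_a.
  have [u Eu _] := child_inv Eoph.
  have Es : status_at h q2 = Some (stat u) by rewrite /status_at Eu.
  by apply: ns; rewrite Es (alive_clean lt_q al Es).
- by split; [exact: root_known|apply: total_weight_root].
- by split=> //; apply: total_weight_safe => //=; lia.
- by case: tok; case: (o) uo.
- by case: tok; case: (o) uo.
- by case: tok; case: (o) uo.
- by case: tok; case: (o) uo.
Qed.

End Step.

End Weight.

(** * Lock-freedom of updates *)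

Section LockFree.

Variables (c : nat -> config) (sched : nat -> option 'I_p) (G : addr -> ghost).
Hypotheses (exec : execution R c sched) (ok : forall m, config_ok G (c m)).
Hypothesis ext1 : forall m, heap_ext (memory (c m)) (memory (c m.+1)).

Local Notation H m := (memory (c m)).
Implicit Types (t : 'I_p) (o : operation).

Variable n : nat.
Hypothesis no_completion :
  forall m t, n <= m -> ~ completes (@is_update disp K V) c sched t m.

Lemma update_not_return m t o r : n <= m -> is_update o -> sched m = Some t ->
  threads (c m) t = Running o (Return r) -> threads (c m.+1) t <> Idle r.
Proof.
move=> le uo Es E E'; apply: (no_completion (t := t) le); split=> //.
  by exists o, (Return r).
by exists r.
Qed.

(** After a successful update DCSS an operation never restarts. Without completions this set of
    states is therefore never left, and each thread updates at most once more. *)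
Definition has_updated (x : thread) : Prop :=
  match x with
  | Running o s => is_update o /\
      match s with
      | IncrCounts _ _ | CheckCounts _ _ | StartRebuild _ _ _
      | Help _ Finish _ | Return _ => True
      | _ => False
      end
  | _ => False
  end.

Lemma has_updated_step m t : n <= m ->
  has_updated (threads (c m) t) -> has_updated (threads (c m.+1) t).
Proof.
move=> le up; case: (thread_step exec m t) => [->//|[Es tr]].
have [x Ex] : exists x, threads (c m.+1) t = x by eexists.
rewrite Ex in tr *; case: tr Ex up => [r o -> //|o s s' E st _|o r E Ex].
  by rewrite E => -[uo]; case: st => //= op [].
by rewrite E => -[uo _]; case: (update_not_return le uo Es E Ex).
Qed.

Let all_nodes := fun _ : addr => True.

Lemma no_update_eventually : exists2 N, n <= N &
  forall t m, N <= m -> ~ update_in c all_nodes m t.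
Proof.
apply: eventually_fin => t.
apply: (@eventually_not _ (fun m => has_updated (threads (c m) t))).
- move=> m _ [o [ns [k [i [a [E -> _]]]]]].
  by have [uo _ _ _] := thread_okm ok E.
- by move=> m; apply: has_updated_step.
- by move=> m _ + [o [ns [k [i [a [E _ _]]]]]]; rewrite E => -[].
Qed.

Lemma pending_update m t : n <= m -> executing (@is_update disp K V) (c m) t ->
  exists2 o, is_update o &
    forall k, m <= k -> exists s, threads (c k) t = Running o s.
Proof.
move=> le [o [s [E uo]]]; exists o => // k /subnK<-.
elim: (k - m) => [|d [s' E']]; first by exists s.
rewrite addSn; case: (thread_step exec (d + m) t) => [->|[Es tr]]; first by
  exists s'.
have [x Ex] : exists x, threads (c (d + m).+1) t = x by eexists.
rewrite Ex E' in tr *; case: tr Ex => [r o' //|o' s1 s2|o' r].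
  by case=> <- _ _ _; exists s2.
case=> eo es Ex; rewrite es in E'.
by case: (update_not_return _ uo Es E' Ex); lia.
Qed.

(** Once the slots are constant, the heap at time [N] serves as the reference for the weights, and
    every further step of the thread lowers its total weight. *)
Lemma update_false t :
  (forall N, exists2 m, N <= m &
     sched m = Some t /\ executing (@is_update disp K V) (c m) t) -> False.
Proof.
move=> inf; have [m0 le0 [_ ex0]] := inf n.
have [o uo pending] := pending_update le0 ex0.
have taken : taken_forever sched t by move=> k; have [m le [Es _]] := inf k;
  exists m.
have [N1 le1 noU] := no_update_eventually.
have [|N le2 [noR static]] := eventually_static exec ok ext1 (S := all_nodes)
  (n := maxn N1 m0) (fun _ _ => I).
  by move=> m t'; rewrite geq_max => /andP[le _]; apply: noU.
pose Q (x : thread) := exists2 s, x = Running o s & pc_known (H N) s.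
pose mu (x : thread) := if x is Running _ s then total_weight G (H N) s else 0.
apply: (@measure_false _ _ exec t N Q mu) => //.
  have [|s E] := pending N; first by lia.
  by exists s => //; apply: thread_ok_known (thread_okm ok E).
move=> m le Es [s E kn]; have tok := thread_okm ok E.
have := sched_trans exec Es.
have [x Ex] : exists x, threads (c m.+1) t = x by eexists.
rewrite Ex E => tr; case: tr Ex => [r o' //|o' s1 s2|o' r].
  case=> <- <- st Ex.
  have [||||kn' lt] := op_step_weight (heap_okm ok N) (heap_okm ok m)
    (ext_le ext1 le) _ _ uo tok kn st.
  - by move=> q i lt_q; apply: static.
  - by move=> q i lt_q; apply: static => //; apply: leqW.
  - move=> ns k i a Es1 Es2; apply: (noU t m); first by lia.
    by exists o, ns, k, i, a; rewrite E Ex Es1 Es2.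
  - move=> a q i op Es1 Es2; apply: (noR m t) => //.
    by exists o, a, q, i, op; rewrite E Ex Es1 Es2.
  by split=> //; exists s2.
case=> eo es Ex; rewrite es in E.
by case: (update_not_return _ uo Es E Ex); lia.
Qed.

End LockFree.

End ConcurrentIST.

Theorem theorem3p13 (disp : Order.disp_t) (K : orderType disp) (V : Type)
    (F : realType) (R : F) (hR : (0 < R)%R) (p : nat) :
  lock_free R p (@is_update disp K V) /\ wait_free R p (@is_lookup disp K V).
Proof.
split; last exact: lookup_wait_free.
split; first exact: never_stuck_any.
move=> c sched exec inf n; apply: contrapT => no.
have [G [ok ext1]] := execution_config_ok exec.
have no_completion m t : n <= m -> ~ completes (@is_update disp K V) c sched t
  m.
  by move=> le co; apply: no; exists m, t.
(* If no single thread took infinitely many steps of updates, all such steps would stop, as there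
   are finitely many threads. *)
have [N _ quiet] : exists2 N, 0 <= N & forall t m, N <= m ->
    ~ (sched m = Some t /\ executing (@is_update disp K V) (c m) t).
  apply: eventually_fin => t; apply: contrapT => often.
  apply: (update_false exec ok ext1 no_completion (t := t)) => N.
  apply: contrapT => none; apply: often; exists N => // m le both.
  by apply: none; exists m.
by have [m [t [le Es ex]]] := inf N; apply: (quiet t m le).
Qed.
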